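(* Let $T,N\in\mathbb N$ and let $\mu^1,\dots,\mu^N$ be Borel probability measures on $\mathbb R^T$ such that for each $i$ the canonical process $X^i$ is an $(\mathbb F^i,\mu^i)$-martingale and the market consisting of $X^i$ is complete. Let $\xi:\mathbb R^{T\cdot N}\to\mathbb R$ be measurable and such that there exist $f^i\in\mathbb L^1(\mu^i)$ with $\xi(x^1,\dots,x^N)\le\sum_{i=1}^Nf^i(x^i)$. Then the problem $p(\xi)$ admits a solution (the infimum defining $p(\xi)$ is attained). If, further, $\xi$ is upper-semicontinuous and there exist $h^i\in\mathbb L^1(\mu^i)$ with $-\xi(x^1,\dots,x^N)\le\sum_{i=1}^Nh^i(x^i)$, then $\sup\{\mathbb E^{\mathbb P}[\xi]:\mathbb P\in\mathrm{Cpl}_{\mathrm{mc}}(\mu^1,\dots,\mu^N)\}$ is attained. That is, in this case there exist $\pi^\star\in\mathrm{Cpl}_{\mathrm{mc}}(\mu^1,\dots,\mu^N)$, $\mathbf\Delta^\star\in\mathcal A$ and $p_0^\star\in\mathbb R$ such that $p_0^\star=p(\xi)$, $$p_0^\star+\sum_{t=1}^T\mathbf\Delta^\star_{t-1}\cdot(\mathbf X_t-\mathbf X_{t-1})\ge\xi(\mathbf X)\qquad\mathrm{Cpl}_{\mathrm{mc}}(\mu^1,\dots,\mu^N)\text{-quasi-surely},$$ and equality holds $\pi^\star$-almost surely. In particular $p(\xi)=\mathbb E^{\pi^\star}[\xi]$.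
   Context: $X^i=(X^i_t)_{t=1}^T$ is the canonical process on $\mathbb R^T$, $\mathbb F^i$ its canonical filtration, with $\mathcal F^i_0$ trivial; $X^i_0:=x^i_0:=\mathbb E^{\mu^i}[X^i_1]$. Completeness of the market consisting of $X^i$: for every $(\mathbb F^i,\mu^i)$-martingale $M^i$ there is an $\mathbb F^i$-adapted real process $\Delta^i=(\Delta^i_t)_{t=0}^{T-1}$ with $M^i_t=m^i_0+\sum_{s=1}^t\Delta^i_{s-1}(X^i_s-X^i_{s-1})$ $\mu^i$-a.s. for all $t\in\{0,\dots,T\}$, where $M^i_0=m^i_0:=\mathbb E^{\mu^i}[M^i_1]$. $\mathbf X=(X^1,\dots,X^N)$ is the $\mathbb R^N$-valued canonical process on $\mathbb R^{T\cdot N}$ (with $\mathbf X_0=(x^1_0,\dots,x^N_0)$) and $\mathbb F^{\mathbf X}$ its filtration ($\mathcal F^{\mathbf X}_0$ trivial). $\mathrm{Cpl}_{\mathrm{mc}}(\mu^1,\dots,\mu^N)$ is the set of multicausal couplings: Borel probability measures $\pi$ on $(\mathbb R^T)^N$ with marginals $\mu^1,\dots,\mu^N$ such that for every $i$ and $t\in\{1,\dots,T\}$, under $\pi$, $(X^i_1,\dots,X^i_T)$ is independent of $\{(X^j_1,\dots,X^j_t):j\ne i\}$ given $(X^i_1,\dots,X^i_t)$. A statement holds $\mathrm{Cpl}_{\mathrm{mc}}$-quasi-surely (q.s.) if it holds outside a Borel set that is null for all $\pi\in\mathrm{Cpl}_{\mathrm{mc}}(\mu^1,\dots,\mu^N)$.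 $\mathcal A$ is the set of $\mathbb F^{\mathbf X}$-adapted $\mathbb R^N$-valued processes $\mathbf\Delta=(\mathbf\Delta_t)_{t=0}^{T-1}$ on $\mathbb R^{T\cdot N}$. The superhedging price is $$p(\xi):=\inf\Big\{p_0\in\mathbb R\ \Big|\ \exists\,\mathbf\Delta\in\mathcal A:\ p_0+\sum_{t=1}^T\mathbf\Delta_{t-1}\cdot(\mathbf X_t-\mathbf X_{t-1})\ge\xi(\mathbf X)\ \ \mathrm{Cpl}_{\mathrm{mc}}(\mu^1,\dots,\mu^N)\text{-q.s.}\Big\}.$$ *)

(* Defs.v *)
From HB Require Import structures.
From mathcomp Require Import all_boot all_order all_algebra.
From mathcomp Require Import all_classical all_reals all_analysis.

Set Implicit Arguments.
Unset Strict Implicit.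
Unset Printing Implicit Defensive.

Import Order.TTheory GRing.Theory Num.Theory.
Import numFieldNormedType.Exports.

Local Open Scope classical_set_scope.
Local Open Scope ring_scope.

(* The path space R^T is [T.-tuple R] and (R^T)^N is [N.-tuple (T.-tuple R)],
   with the product sigma-algebras, which are the Borel ones.  Processes are
   indexed by [nat]; only the times up to the horizon T are ever constrained. *)

Section Probability.
Context {R : realType} d (O : measurableType d).
Implicit Types (P : probability O R) (G H : set (set O)).

Definition measurable_wrt d' (E : measurableType d') G (f : O -> E) : Prop :=
  forall B : set E, measurable B -> G (f @^-1` B).

(* sigma(Y_1, ..., Y_t); for t = 0 this is the trivial sigma-algebra *)
Definition natural_filtration d' (E : measurableType d') (Y : nat -> O -> E)
    (t : nat) : set (set O) :=
  g_sigma_preimage (fun s : 'I_t => Y s.+1).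

(* g is a version of the conditional expectation E^P[f | G] *)
Definition cond_expectation P G (f g : O -> R) : Prop :=
  [/\ measurable_wrt G g,
      P.-integrable setT (EFin \o g) &
      forall A, G A ->
        (\int[P]_(x in A) (g x)%:E = \int[P]_(x in A) (f x)%:E)%E].

(* G1 and G2 are independent given H under P: almost surely,
   P(A `&` B | H) = P(A | H) P(B | H) *)
Definition cond_independent P G1 G2 H : Prop :=
  forall A B, G1 A -> G2 B ->
  exists f g : O -> R,
    [/\ cond_expectation P H \1_A f,
        cond_expectation P H \1_B g &
        cond_expectation P H \1_(A `&` B) (fun x => f x * g x)].

Definition martingale P (F : nat -> set (set O)) (T : nat)
    (M : nat -> O -> R) : Prop :=
  [/\ forall t, (t <= T)%N -> measurable_wrt (F t) (M t),
      forall t, (t <= T)%N -> P.-integrable setT (EFin \o M t) &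
      forall s t, (s <= t <= T)%N -> cond_expectation P (F s) (M t) (M s)].

End Probability.

Section SingleMarket.
Context {R : realType} {T : nat}.
Implicit Types mu : probability (T.-tuple R) R.

(* X_t for t in {1, ..., T} *)
Definition path_coord (t : nat) (x : T.-tuple R) : R := x`_t.-1.

(* X_t for t in {0, ..., T}, started at X_0 := E^mu[X_1] *)
Definition asset mu (t : nat) (x : T.-tuple R) : R :=
  if t == 0%N then fine 'E_mu[path_coord 1] else path_coord t x.

Definition asset_filtration : nat -> set (set (T.-tuple R)) :=
  natural_filtration path_coord.

Definition complete_market mu : Prop :=
  forall M : nat -> T.-tuple R -> R,
    martingale mu asset_filtration T M ->
    exists Delta : nat -> T.-tuple R -> R,
      (forall t, (t < T)%N ->
         measurable_wrt (asset_filtration t) (Delta t)) /\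
      (forall t, (t <= T)%N ->
         {ae mu, forall x,
           M t x = fine 'E_mu[M 1%N] +
             \sum_(s < t) Delta s x * (asset mu s.+1 x - asset mu s x)}).

End SingleMarket.

Section JointMarket.
Context {R : realType} {T N : nat}.
Context (mu : 'I_N -> probability (T.-tuple R) R).

Local Notation paths := (N.-tuple (T.-tuple R)).

Definition coord_of (i : 'I_N) (t : nat) (x : paths) : R := path_coord t (tnth x i).

Definition joint_coord (t : nat) (x : paths) : N.-tuple R :=
  [tuple coord_of i t x | i < N].

Definition joint_filtration : nat -> set (set paths) :=
  natural_filtration joint_coord.

(* sigma(X^j_1, ..., X^j_t : j <> i) *)
Definition others_filtration (i : 'I_N) (t : nat) : set (set paths) :=
  <<s \bigcup_(j in [set j | j != i]) natural_filtration (coord_of j) t >>.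

Definition multicausal : set (probability paths R) :=
  [set pi : probability paths R | (forall i (A : set (T.-tuple R)), measurable A ->
               pi ((fun x => tnth x i) @^-1` A) = mu i A) /\
            (forall i t, (1 <= t <= T)%N ->
               cond_independent pi
                 (natural_filtration (coord_of i) T)
                 (others_filtration i t)
                 (natural_filtration (coord_of i) t))].

Definition quasi_surely (Q : paths -> Prop) : Prop :=
  exists B : set paths,
    [/\ measurable B,
        forall pi, multicausal pi -> pi B = 0%E &
        forall x, ~ B x -> Q x].

Definition strategy (Delta : nat -> paths -> N.-tuple R) : Prop :=
  forall t, (t < T)%N -> measurable_wrt (joint_filtration t) (Delta t).

Definition gains (Delta : nat -> paths -> N.-tuple R) (x : paths) : R :=
  \sum_(t < T) \sum_(i < N)
    tnth (Delta t x) i *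
    (asset (mu i) t.+1 (tnth x i) - asset (mu i) t (tnth x i)).

Definition superhedges (xi : paths -> R) (p0 : R)
    (Delta : nat -> paths -> N.-tuple R) : Prop :=
  strategy Delta /\ quasi_surely (fun x => p0 + gains Delta x >= xi x).

Definition superhedging_price (xi : paths -> R) : \bar R :=
  ereal_inf [set p0%:E | p0 in
    [set p0 | exists Delta, superhedges xi p0 Delta]].

End JointMarket.

(* The topology of R^(T N) is that of the matrices, whose rows are the paths. *)
Definition upper_semicontinuous {R : realType} {T N : nat}
    (xi : N.-tuple (T.-tuple R) -> R) : Prop :=
  lower_semicontinuous (fun A : 'M[R]_(N, T) =>
    (- xi [tuple [tuple A i t | t < T] | i < N])%:E).

(* Main.v *)
Require Import Defs.
From HB Require Import structures.
From mathcomp Require Import all_boot all_order all_algebra.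
From mathcomp Require Import all_classical all_reals all_analysis.
From mathcomp Require Import ring lra measurable_realfun.

Set Implicit Arguments.
Unset Strict Implicit.
Unset Printing Implicit Defensive.

Import Order.TTheory GRing.Theory Num.Theory.
Import numFieldNormedType.Exports.

Local Open Scope classical_set_scope.
Local Open Scope ring_scope.

(** The theorem holds because complete markets started from a trivial
sigma-algebra are finite trees, which turns superhedging into a finite linear
program whose dual variables are the multicausal couplings.

Finiteness. Fix a history y up to time t of positive probability and let B be
the event that this history occurs and that the next price exceeds the current
one. The martingale closed by the indicator of B is replicable, and on the atom
of y every term of its replication is constant except the next price. So the
indicator of B is there an affine function of the next price. If the slope is
nonzero, the next price takes at most two values; if it is zero, the next price
lies almost surely on one side of its conditional mean and hence equals it
([binary_branching]). Each history thus has at most two successors, each law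
mu^i charges finitely many paths ([complete_market_finite_support]), and all
multicausal couplings live on the finite set S of tuples of charged paths.

Linear programming. Minimising p0 subject to p0 + gains >= xi on S is a linear
program. By Farkas' lemma ([farkas]) both it and its dual have optimisers, with
the same value ([lp_strong_duality]), as soon as the dual has a feasible point.
Dual feasible points are the probabilities on S under which all gains from
trade are centred, that is, under which each price is a martingale for the
joint filtration.

Couplings. These martingale measures are exactly the multicausal couplings. The
link is the identity [causal_mass]: given the joint history, a path z of
asset i has the conditional probability that mu^i assigns to it given its own
history. A joint martingale measure satisfies it because the indicator of z is
replicable by trading in asset i ([martingale_causal_mass]). The identity
contains both the marginals and the conditional independences
([causal_multicausal], [multicausal_causal_mass]), and it forces all gains to
be centred ([causal_mass_increment]). The product of the mu^i is a feasible
point ([product_mass_martingale]).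

Integrating a superhedge against an optimal coupling shows that the price is the
value of the program, integrating the optimal hedge against any coupling shows
that this value is the supremum of the expectations, and complementary
slackness is the equality almost surely ([superhedging_duality]). *)

(** * Linear programming duality *)

Lemma scalar_lin (F : realFieldType) (E : lmodType F) (f : E -> F) :
  scalar f -> (forall u v, f (u + v) = f u + f v) *
    (forall a v, f (a *: v) = a * f v) * (f 0 = 0).
Proof.
move=> linf.
have f0 : f 0 = 0.
  by have := linf (-1) 0 0; rewrite scaleN1r addNr mulN1r addNr.
split=> //; split=> [u v|a v].
  by have := linf 1 u v; rewrite scale1r mul1r.
by have := linf a v 0; rewrite !addr0 f0 addr0.
Qed.

(** Induction on the constraints: if dropping the constraint [l k] breaks the
implication, some [u] satisfies the other constraints and violates the
conclusion, and projecting along [u] onto the kernel of [l k] reduces to the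
other constraints. *)
Lemma farkas (F : realFieldType) (E : lmodType F) (I : eqType) (s : seq I) :
  uniq s -> forall (l : I -> E -> F) (f : E -> F),
  (forall i, scalar (l i)) -> scalar f ->
  (forall v, (forall i, i \in s -> 0 <= l i v) -> 0 <= f v) ->
  exists c : I -> F, (forall i, 0 <= c i) /\
    (forall v, f v = \sum_(i <- s) c i * l i v).
Proof.
elim: s => [_ l f _ linf f_ge0|k s IHs /= /andP[ks us] l f linl linf f_ge0].
  exists (fun=> 0); split => // v; rewrite big_nil.
  have fN : f (- v) = - f v by rewrite -scaleN1r (scalar_lin linf) mulN1r.
  have := f_ge0 v; have := f_ge0 (- v); rewrite fN => fv1 fv2.
  have {}fv1 : 0 <= - f v by apply: fv1.
  have {}fv2 : 0 <= f v by apply: fv2.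
  lra.
case: (pselect (forall v, (forall i, i \in s -> 0 <= l i v) -> 0 <= f v)).
  move=> /(IHs us l f linl linf)[c [c0 cE]].
  exists (fun i => if i == k then 0 else c i); split => [i|v].
    by case: ifP.
  rewrite big_cons eqxx mul0r add0r cE.
  apply: eq_big_seq => i si; case: eqP => // ik.
  by rewrite -ik si in ks.
move=> /existsNP[u0 /not_implyP[su0 /negP]]; rewrite -ltNge => fu0.
have lu0 : l k u0 < 0.
  rewrite ltNge; apply/negP => lk0; move: fu0; rewrite ltNge => /negP; apply.
  by apply: f_ge0 => i; rewrite inE => /orP[/eqP ->|/su0].
pose u := (- l k u0)^-1 *: u0.
have ku : l k u = -1.
  by rewrite (scalar_lin (linl k)) invrN mulNr mulVf// lt_eqF.
have su i : i \in s -> 0 <= l i u.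
  move=> si; rewrite (scalar_lin (linl i)); apply: mulr_ge0; last exact: su0.
  by rewrite invr_ge0; lra.
have fu : f u <= 0.
  rewrite (scalar_lin linf); apply: mulr_ge0_le0; last exact: ltW.
  by rewrite invr_ge0; lra.
clearbody u.
(* [pr] projects onto the kernel of [l k] along [u]; on its range the
   constraint [l k] holds for free, so the induction hypothesis applies to
   the functionals composed with [pr]. *)
pose pr v := v + l k v *: u.
have linpr a v w : pr (a *: v + w) = a *: pr v + pr w.
  by rewrite /pr (linl k) scalerDl scalerDr scalerA addrACA.
have [||v Hv|c [c0 cE]] := IHs us (fun i => l i \o pr) (f \o pr).
- by move=> i a v w /=; rewrite linpr linl.
- by move=> a v w /=; rewrite linpr linf.
- apply: f_ge0 => i; rewrite inE => /orP[/eqP ->|/Hv//].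
  by rewrite /pr !(scalar_lin (linl k)) ku mulrN1 subrr.
exists (fun i => if i == k then - f u + \sum_(i <- s) c i * l i u else c i).
split=> [i|v].
  case: ifP => // _; apply: addr_ge0; first lra.
  by rewrite big_seq sumr_ge0// => j sj; rewrite mulr_ge0// su.
rewrite big_cons eqxx.
transitivity ((- f u + \sum_(i <- s) c i * l i u) * l k v +
  \sum_(i <- s) c i * l i v); last first.
  congr (_ + _); apply: eq_big_seq => i si; case: eqP => // ik.
  by rewrite -ik si in ks.
have := cE v; rewrite /= {1}/pr !(scalar_lin linf) => fE.
have -> : f v = \sum_(i <- s) c i * l i (pr v) - l k v * f u.
  by rewrite -fE addrK.
have -> : \sum_(i <- s) c i * l i (pr v) =
    \sum_(i <- s) c i * l i v + l k v * \sum_(i <- s) c i * l i u.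
  rewrite big_distrr/= -big_split/=; apply: eq_bigr => i _.
  by rewrite /pr !(scalar_lin (linl i)); ring.
ring.
Qed.

Section LinearProgramming.
Context {R : realType} {X : eqType} {E : lmodType R}.
Variables (s : seq X) (g : X -> E -> R) (xi : X -> R).
Hypothesis us : uniq s.
Hypothesis ling : forall x, scalar (g x).

(** The states [x] range over [s], the vector [w] is free, and [g x w] is its
gain in state [x]; since [w] has no sign, dual variables must annihilate all
gains, and since the cost [p] is the same in all states, they have total
mass 1. *)
Definition dual_feasible (pi : X -> R) :=
  [/\ forall x, 0 <= pi x, \sum_(x <- s) pi x = 1 &
      forall w, \sum_(x <- s) pi x * g x w = 0].

Definition dominated p := exists w, forall x, x \in s -> xi x <= p + g x w.

Lemma lp_weak_duality pi p : dual_feasible pi -> dominated p ->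
  \sum_(x <- s) pi x * xi x <= p.
Proof.
move=> [pi0 pi1 pig] [w wp].
have -> : p = \sum_(x <- s) pi x * (p + g x w).
  under eq_bigr do rewrite mulrDr.
  by rewrite big_split/= pig addr0 -big_distrl/= pi1 mul1r.
rewrite big_seq [leRHS]big_seq.
by apply: ler_sum => x sx; rewrite ler_wpM2l// wp.
Qed.

(** Farkas' lemma is applied twice to homogeneous systems in which a scalar
multiplies [xi]. If the infimum [ps] were not attained, the multipliers of the
first system would normalise to a dual feasible point of value above [ps]. The
second system says that [p - ps * tau] is nonnegative whenever [p] dominates
[tau] copies of [xi]; its multipliers are a dual feasible point of value at
least [ps]. A given dual feasible point bounds the primal problem from below
and settles the case [tau = 0]. *)
Lemma lp_strong_duality : (exists pi, dual_feasible pi) ->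
  exists p w pi, [/\ forall x, x \in s -> xi x <= p + g x w,
    dual_feasible pi & \sum_(x <- s) pi x * xi x = p].
Proof.
move=> [pi0 pi0F].
have linD x v w : g x (v + w) = g x v + g x w by rewrite (scalar_lin (ling x)).
have lin0 x : g x 0 = 0 by rewrite (scalar_lin (ling x)).
have linZ x a v : g x (a *: v) = a * g x v by rewrite (scalar_lin (ling x)).
pose ps := inf dominated.
have domlb pi : dual_feasible pi -> lbound dominated (\sum_(x <- s) pi x * xi x).
  by move=> piF p; exact: lp_weak_duality.
have domne : dominated !=set0.
  exists (\sum_(x <- s) `|xi x|), 0 => x sx; rewrite lin0 addr0.
  rewrite (le_trans (ler_norm _))// (bigD1_seq x)//= lerDl.
  by rewrite sumr_ge0.
have hasinf : has_inf dominated.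
  by split=> //; exists (\sum_(x <- s) pi0 x * xi x); exact: domlb.
have ps_lb p : dominated p -> ps <= p.
  by move=> Dp; apply: ge_inf => //; case: hasinf.
(* A vector [(tau, w)] with [tau > 0] meeting the constraints would give the
   hedge [w / tau] at cost [ps]. *)
have [w wps] : dominated ps.
  apply: contrapT => Nps.
  have [||v Hv|c [c0 cE]] := @farkas R (R^o * E)%type X s us
    (fun x v => ps * (v.1 : R) + g x v.2 - (v.1 : R) * xi x)
    (fun v => - (v.1 : R)).
  - move=> x a u v; rewrite /= /GRing.scale/= linD linZ; ring.
  - move=> a u v; rewrite /= /GRing.scale/=; ring.
  - rewrite oppr_ge0 leNgt; apply/negP => v0; apply: Nps.
    exists ((v.1 : R)^-1 *: v.2) => x sx.
    rewrite linZ -(@ler_pM2l _ (v.1 : R))//.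
    rewrite mulrDr mulrA mulfV ?gt_eqF// mul1r.
    by have := Hv _ sx; lra.
  have cg v : \sum_(x <- s) c x * g x v = 0.
    have := cE (0, v); rewrite /= oppr0 => /esym; apply: etrans.
    by apply: eq_bigr => x _; rewrite mulr0 mul0r add0r subr0.
  have c1 : \sum_(x <- s) c x * (xi x - ps) = 1.
    have := cE (1, 0); rewrite /= => /(congr1 -%R); rewrite opprK => ->.
    rewrite -sumrN; apply: eq_bigr => x _; rewrite lin0; ring.
  have csum : 0 < \sum_(x <- s) c x.
    rewrite lt_def sumr_ge0 ?andbT// psumr_neq0//; apply/negP => /negP.
    rewrite -all_predC => /allP cs0.
    have : \sum_(x <- s) c x * (xi x - ps) = 0.
      rewrite big_seq big1// => x /cs0 /=; rewrite lt_def c0 andbT negbK.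
      by move=> /eqP ->; rewrite mul0r.
    by rewrite c1 => /eqP; rewrite oner_eq0.
  pose q := \sum_(x <- s) c x.
  have qF : dual_feasible (fun x => c x / q).
    split=> [x||v]; first by rewrite divr_ge0// ltW.
      by rewrite -big_distrl/= mulfV// gt_eqF.
    under eq_bigr do rewrite mulrAC.
    by rewrite -big_distrl/= cg mul0r.
  have : ps + q^-1 <= ps.
    apply: lb_le_inf => // p Dp; apply: le_trans (lp_weak_duality qF Dp).
    have -> : \sum_(x <- s) c x / q * xi x =
       \sum_(x <- s) c x * (xi x - ps) / q + ps * (\sum_(x <- s) c x / q).
      rewrite big_distrr/= -big_split/=; apply: eq_bigr => x _; ring.
    by case: qF => _ -> _; rewrite mulr1 -big_distrl/= c1 mul1r addrC.
  rewrite gerDl leNgt invr_gt0 => /negP; apply; exact: csum.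
(* The vectors are triples [(p, tau, w)], and [None] indexes the constraint
   [0 <= tau]. *)
have usN : uniq (None :: map Some s).
  rewrite /= map_inj_uniq ?us ?andbT; last by move=> ? ? [].
  by apply/mapP => -[].
have [||v Hv|c [c0 cE]] := @farkas R (R^o * R^o * E)%type (option X)
    (None :: map Some s) usN
    (fun o v => if o is Some x then
       (v.1.1 : R) + g x v.2 - (v.1.2 : R) * xi x else v.1.2)
    (fun v => (v.1.1 : R) - ps * (v.1.2 : R)).
- case=> [x|] a u v; rewrite /= /GRing.scale/= ?linD ?linZ; ring.
- move=> a u v; rewrite /= /GRing.scale/=; ring.
- have : 0 <= (v.1.2 : R) by apply: (Hv None); rewrite mem_head.
  have {}Hv x : x \in s -> 0 <= (v.1.1 : R) + g x v.2 - (v.1.2 : R) * xi x.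
    move=> sx; apply: (Hv (Some x)); rewrite inE/=; apply/mapP; by exists x.
  rewrite le_eqVlt => /orP[/eqP v0|v0].
    rewrite -v0 mulr0 subr0; have [pi00 pi01 pi0g] := pi0F.
    have -> : (v.1.1 : R) = \sum_(x <- s) pi0 x * ((v.1.1 : R) + g x v.2).
      under eq_bigr do rewrite mulrDr.
      by rewrite big_split/= pi0g addr0 -big_distrl/= pi01 mul1r.
    rewrite big_seq sumr_ge0// => x sx; rewrite mulr_ge0//.
    by have := Hv _ sx; rewrite -v0 mul0r subr0.
  have : ps <= (v.1.1 : R) / (v.1.2 : R).
    apply: ps_lb; exists ((v.1.2 : R)^-1 *: v.2) => x sx.
    rewrite linZ -(@ler_pM2l _ (v.1.2 : R))//.
    have -> : (v.1.2 : R) * ((v.1.1 : R) / (v.1.2 : R) + (v.1.2 : R)^-1 * g x v.2)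
        = (v.1.1 : R) + g x v.2 by field; rewrite gt_eqF.
    by have := Hv _ sx; lra.
  by rewrite ler_pdivlMr//; lra.
pose pi x := c (Some x).
have sumE v : (v.1.1 : R) - ps * (v.1.2 : R) = c None * (v.1.2 : R) +
    \sum_(x <- s) pi x * ((v.1.1 : R) + g x v.2 - (v.1.2 : R) * xi x).
  by have := cE v; rewrite big_cons big_map.
have piF : dual_feasible pi.
  split=> [x|| v]; first exact: c0.
    have := sumE (1, 0, 0); rewrite /= !mulr0 subr0 add0r => sE; rewrite [RHS]sE.
    by apply: eq_bigr => x _; rewrite lin0 mul0r; ring.
  have := sumE (0, 0, v); rewrite /= !mulr0 subr0 add0r => sE; rewrite [RHS]sE.
  by apply: eq_bigr => x _; rewrite mul0r; ring.
exists ps, w, pi; split => //.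
apply/eqP; rewrite eq_le; apply/andP; split.
  by apply: lp_weak_duality => //; exists w.
have := sumE (0, 1, 0); rewrite /= sub0r !mulr1 => psE.
rewrite -(opprK ps) psE opprD -sumrN.
have -> : \sum_(x <- s) - (pi x * (0 + g x 0 - 1 * xi x)) =
  \sum_(x <- s) pi x * xi x.
  by apply: eq_bigr => x _; rewrite lin0; ring.
by rewrite gerDr oppr_le0.
Qed.

End LinearProgramming.

(** * Finitely supported probabilities *)

Section FiniteSupport.
Context {R : realType} d (O : measurableType d).
Hypothesis mset1 : forall x : O, measurable [set x].

Lemma measurable_seq (s : seq O) : measurable [set` s].
Proof.
have -> : [set` s] = \big[setU/set0]_(x <- s) [set x].
  rewrite -bigcup_seq; apply/seteqP; split=> [x sx|x [y sy ->]//].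
  by exists x.
exact: bigsetU_measurable.
Qed.

Definition supported (P : probability O R) (s : seq O) := P (~` [set` s]) = 0%E.
Definition mass (P : probability O R) (x : O) : R := fine (P [set x]).

Lemma mass_ge0 (P : probability O R) x : 0 <= mass P x.
Proof. by rewrite fine_ge0. Qed.

Lemma massE (P : probability O R) x : P [set x] = (mass P x)%:E.
Proof. by rewrite /mass fineK// fin_num_measure. Qed.

Section Integral.
Variables (P : probability O R) (s : seq O).
Hypotheses (us : uniq s) (Ps : supported P s).

(** Equal to [f] off a null set, and a combination of indicators: whence the
integrability of every measurable function. *)
Let simple (f : O -> R) (x : O) : \bar R :=
  (\sum_(y <- s) (f y)%:E * (\1_[set y] x)%:E)%E.

Let simpleE f x : x \in s -> simple f x = (f x)%:E.
Proof.
move=> sx; rewrite /simple (bigD1_seq x)//= indicE mem_set// mule1.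
rewrite big1 ?adde0// => y yx; rewrite indicE memNset ?mule0//.
by move=> /= xy; rewrite xy eqxx in yx.
Qed.

Let integrable_simple f : P.-integrable setT (simple f).
Proof.
apply: integrable_sum => // y _; apply: integrableZl => //.
exact: integrable_indic.
Qed.

Lemma integrable_supported (f : O -> R) : measurable_fun setT f ->
  P.-integrable setT (EFin \o f).
Proof.
move=> mf; have mC := measurableC (measurable_seq s).
rewrite (negligible_integrable mC) //; last exact/measurable_EFinP.
apply: (@eq_integrable _ _ _ _ _ _ (simple f)).
- exact: measurableD.
- by move=> x; rewrite inE => -[_ /contrapT/= sx]; rewrite simpleE.
- apply: integrableS (integrable_simple f) => //; exact: measurableD.
Qed.

Lemma integral_supported (f : O -> R) A : measurable_fun setT f ->
  measurable A ->
  (\int[P]_(x in A) (f x)%:E = (\sum_(x <- s) mass P x * (\1_A x * f x))%:E)%E.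
Proof.
move=> mf mA; rewrite (@ae_eq_integral _ _ _ _ _ (simple f))//; last 3 first.
- by apply/measurable_EFinP; exact: measurable_funS mf.
- apply: measurable_int (integrableS _ _ _ (integrable_simple f)) => //.
- exists (~` [set` s]); split => //; first exact/measurableC/measurable_seq.
  by move=> x /=; apply: contra_not => sx _; rewrite simpleE.
rewrite /simple integral_sum//; last first.
  move=> y; apply: integrableZl => //.
  by apply: integrableS (integrable_indic _ _).
rewrite -sumEFin; apply: eq_bigr => y _.
rewrite integralZl//; last by apply: integrableS (integrable_indic _ _).
rewrite integral_indic//.
rewrite [X in (_ * X)%E](_ : _ = (\1_A y * mass P y)%:E); last first.
  rewrite indicE; case: (boolP (y \in A)) => yA.
    rewrite setIidl ?mul1r; [exact: massE|move=> _ ->; exact/set_mem].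
  rewrite mul0r (_ : _ `&` _ = set0) ?measure0//.
  by apply/seteqP; split => // x [-> Ay]; move: yA; rewrite mem_set.
by rewrite -EFinM; congr EFin; ring.
Qed.

Lemma measure_supported A : measurable A ->
  P A = (\sum_(x <- s) mass P x * \1_A x)%:E.
Proof.
move=> mA; have := @integral_supported (cst 1) A ltac:(by []) mA.
rewrite /cst integral_cst// mul1e => ->.
by congr EFin; apply: eq_bigr => x _; rewrite mulr1.
Qed.

Lemma mass_sum1 : \sum_(x <- s) mass P x = 1.
Proof.
have := measure_supported (@measurableT _ O); rewrite probability_setT => -[->].
by apply: eq_bigr => x _; rewrite indicT mulr1.
Qed.

Lemma expectation_supported (f : O -> R) : measurable_fun setT f ->
  ('E_P[f])%E = (\sum_(x <- s) mass P x * f x)%:E.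
Proof.
move=> mf; rewrite unlock integral_supported//.
by congr EFin; apply: eq_bigr => x _; rewrite indicT mul1r.
Qed.

Lemma ae_supported (Q : O -> Prop) :
  (forall x, x \in s -> 0 < mass P x -> Q x) -> {ae P, forall x, Q x}.
Proof.
move=> sQ; pose s0 := [seq x <- s | mass P x == 0].
have s00 : P [set` s0] = 0%E.
  rewrite measure_supported; last exact: measurable_seq.
  congr EFin; rewrite big1// => x _.
  have [->|x0] := eqVneq (mass P x) 0; first by rewrite mul0r.
  by rewrite indicE memNset ?mulr0//= mem_filter (negbTE x0).
exists ([set` s0] `|` ~` [set` s]); split.
- by apply: measurableU; [|apply: measurableC]; exact: measurable_seq.
- apply/eqP; rewrite -measure_le0; apply: (le_trans (measureU2 _ _ _)).
  + exact: measurable_seq.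
  + exact/measurableC/measurable_seq.
  + by rewrite [X in (X + _)%E]s00 [X in (_ + X)%E]Ps adde0.
- move=> x /= NQ; have [sx|/negP sx] := boolP (x \in s); last by right.
  left; rewrite /= mem_filter sx andbT; apply/negPn/negP => x0.
  by apply: NQ; apply: sQ => //; rewrite lt_def x0 mass_ge0.
Qed.

Lemma ae_supportedE (Q : O -> Prop) x : 0 < mass P x ->
  {ae P, forall x, Q x} -> Q x.
Proof.
move=> x0 [B [mB PB NQB]]; apply: contrapT => NQ.
have : (P [set x] <= P B)%E by rewrite le_measure ?inE// => _ ->; exact: NQB.
by rewrite PB massE lee_fin leNgt x0.
Qed.

End Integral.

Lemma ae_mem_supported (P : probability O R) (s : seq O) :
  {ae P, forall x, x \in s} -> supported P s.
Proof.
move=> [B [mB PB sB]]; apply/eqP; rewrite -measure_le0 -[leRHS]PB.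
by rewrite le_measure ?inE//; exact/measurableC/measurable_seq.
Qed.

Lemma discrete_probability (s : seq O) (c : O -> R) : uniq s ->
  (forall x, 0 <= c x) -> \sum_(x <- s) c x = 1 ->
  exists P : probability O R, supported P s /\
    (forall x, x \in s -> mass P x = c x).
Proof.
move=> us c0 c1.
pose m (k : nat) : {measure set O -> \bar R} :=
  mscale (NngNum (c0 (nth point s k))) (@dirac _ O (nth point s k) R).
pose M : {measure set O -> \bar R} := msum m (size s).
have ME A : M A = (\sum_(x <- s) c x * \1_A x)%:E.
  rewrite /M /= /msum (big_nth point) big_mkord -sumEFin.
  by apply: eq_bigr => k _; rewrite /m/= /mscale/= diracE indicE.
have MT : M setT = 1%E.
  rewrite ME -c1; congr EFin; apply: eq_bigr => x _.
  by rewrite indicT mulr1.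
(* [M] has total mass 1, so that normalising it changes nothing. *)
pose P : probability O R := mnormalize M (dirac point).
have PE A : P A = M A.
  by rewrite /P /= /mnormalize MT onee_eq0/= invr1 mule1.
exists P; split=> [|x sx].
  rewrite /supported PE ME big_seq big1// => x sx.
  by rewrite indicE memNset ?mulr0//= => /(_ sx).
rewrite /mass PE ME/= (bigD1_seq x)//= indicE mem_set// mulr1 big1 ?addr0//.
move=> y yx; rewrite indicE memNset ?mulr0//= => xy.
by rewrite xy eqxx in yx.
Qed.

End FiniteSupport.

(** * Sigma-algebras and their atoms *)

(** The fibres of [h] are the atoms of [H]: on a finitely supported probability,
conditioning on [H] only depends on them. *)
Record resolved d (O : measurableType d) (K : eqType) (H : set (set O))
    (h : O -> K) : Prop := Resolved {
  resolved_salg : sigma_algebra setT H;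
  resolved_measurable : H `<=` measurable;
  resolved_saturated : forall G x y, H G -> h x = h y -> G x -> G y;
  resolved_atom : forall y, H [set x | h x = h y] }.

Section SigmaAlgebra.
Context d (O : measurableType d) (H : set (set O)).
Hypothesis sH : sigma_algebra setT H.

Let HE A : H A = @measurable _ (g_sigma_algebraType H) A.
Proof. by rewrite /measurable/= sigma_algebra_id. Qed.

Lemma salgC A : H A -> H (~` A).
Proof. by rewrite !HE; exact: measurableC. Qed.

Lemma salgI A B : H A -> H B -> H (A `&` B).
Proof. by rewrite !HE; exact: measurableI. Qed.

Lemma salgT : H setT.
Proof. by rewrite HE; exact: measurableT. Qed.

Lemma salg0 : H set0.
Proof. by rewrite HE; exact: measurable0. Qed.

Lemma salg_bigcup (I : choiceType) (s : seq I) (F : I -> set O) :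
  (forall i, i \in s -> H (F i)) -> H [set x | exists2 i, i \in s & F i x].
Proof.
move=> HF; rewrite (_ : [set x | _] = \big[setU/set0]_(i <- s | i \in s) F i).
  rewrite HE; apply: bigsetU_measurable => i si; rewrite -HE; exact: HF.
rewrite -big_seq -bigcup_seq; apply/seteqP; split=> x [i]; first by exists i.
by exists i.
Qed.

Lemma salg_bigcap (I : choiceType) (s : seq I) (F : I -> set O) :
  (forall i, i \in s -> H (F i)) -> H [set x | forall i, i \in s -> F i x].
Proof.
move=> HF; have ? := @salg_bigcup I s (fun i => ~` F i) (fun i si => salgC (HF i si)).
rewrite (_ : [set x | forall i, _] = ~` [set x | exists2 i, i \in s & (~` F i) x]).
  exact: salgC.
apply/seteqP; split=> x /=; last first.
  by move=> Nx i si; apply: contrapT => Nxi; apply: Nx; exists i.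
by move=> xF [i si]; apply; exact: xF.
Qed.

End SigmaAlgebra.

Section MeasurableWrt.
Context d (O : measurableType d) (K : eqType) (H : set (set O)) (h : O -> K).
Hypothesis rH : resolved H h.
Context d' (E : measurableType d').
Implicit Types f : O -> E.

Lemma measurable_wrt_measurable f : measurable_wrt H f -> measurable_fun setT f.
Proof. by move=> mf _ B mB; rewrite setTI; apply: (resolved_measurable rH); exact: mf. Qed.

Lemma measurable_wrt_eq f x y : (forall e : E, measurable [set e]) ->
  measurable_wrt H f -> h x = h y -> f x = f y.
Proof.
by move=> mE mf hxy; apply/esym; apply: (resolved_saturated rH (mf _ (mE (f x))) hxy).
Qed.

Lemma measurable_wrt_indic (A : set O) (phi : bool -> E) :
  H A -> measurable_wrt H (fun x => phi (x \in A)).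
Proof.
move=> HA B _; have sH := resolved_salg rH.
have [pT|pT] := pselect (B (phi true)); have [pF|pF] := pselect (B (phi false)).
- rewrite (_ : _ @^-1` _ = setT); first exact: salgT.
  by apply/seteqP; split => // x _ /=; case: (x \in A).
- rewrite (_ : _ @^-1` _ = A) //; apply/seteqP; split => x /=.
    by case: (boolP (x \in A)) => [/set_mem|].
  by move=> Ax; rewrite mem_set.
- rewrite (_ : _ @^-1` _ = ~` A); first exact: salgC.
  apply/seteqP; split => x /=.
    by case: (boolP (x \in A)) => // /negP xA _ Ax; apply: xA; exact: mem_set.
  by move=> Ax; rewrite memNset.
- rewrite (_ : _ @^-1` _ = set0); first exact: salg0.
  by apply/seteqP; split => // x /=; case: (x \in A).
Qed.

(** Preimages are finite unions of atoms, or complements of such when they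
contain the points with value [e0] outside the atoms of [s]. *)
Lemma measurable_wrt_atoms f (s : seq O) (e0 : E) :
  (forall x y, y \in s -> h x = h y -> f x = f y) ->
  (forall x, (forall y, y \in s -> h x != h y) -> f x = e0) ->
  measurable_wrt H f.
Proof.
move=> feq f0 B _; have sH := resolved_salg rH.
pose U (P : pred O) := [set x | exists2 y, y \in [seq y <- s | P y] & h x = h y].
have HU P : H (U P).
  by apply: (salg_bigcup sH (F := fun y => [set x | h x = h y])) => y _;
     exact: resolved_atom rH y.
have UP P x : U P x <-> exists y, [/\ y \in s, P y & h x = h y].
  split=> [[y]|[y [sy Py hxy]]]; first by rewrite mem_filter => /andP[]; exists y.
  by exists y => //; rewrite mem_filter Py.
have fNU x : ~ U predT x -> f x = e0.
  move=> Nx; apply: f0 => y sy; apply/eqP => hxy; apply: Nx; apply/UP.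
  by exists y.
pose V := U (fun y => `[< B (f y) >]).
have VE x : U predT x -> V x <-> B (f x).
  move=> /UP[y [sy _ hxy]]; split=> [/UP[z [sz /asboolP Bz hxz]]|Bx].
    by rewrite (feq _ _ sz hxz).
  by apply/UP; exists y; split => //; apply/asboolP; rewrite -(feq _ _ sy hxy).
have VU x : V x -> U predT x by move=> /UP[y [sy _ hxy]]; apply/UP; exists y.
have [Be0|Be0] := pselect (B e0).
  rewrite (_ : _ @^-1` _ = ~` (U predT `&` ~` V)).
    exact: (salgC sH (salgI sH (HU _) (salgC sH (HU _)))).
  apply/seteqP; split => x /= Hx.
    by move=> [Ux]; apply; exact/VE.
  have [Ux|Nx] := pselect (U predT x); last by rewrite fNU.
  by apply/VE => //; apply: contrapT => NV; apply: Hx.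
rewrite (_ : _ @^-1` _ = V); first exact: HU.
apply/seteqP; split => x /= Hx.
  have [Ux|Nx] := pselect (U predT x); first exact/VE.
  by move: Hx; rewrite fNU.
by apply/VE => //; exact: VU.
Qed.

End MeasurableWrt.

(** Hence a sigma-algebra whose generators do not separate the fibres of [h]
contains no event that does. *)
Lemma saturated_salg (O K : Type) (h : O -> K) :
  sigma_algebra setT [set G | forall x y, h x = h y -> G x -> G y].
Proof.
split=> //=.
- by move=> A sA x y hxy [_ NAx]; split => // Ay; apply: NAx; exact: sA Ay.
- by move=> F sF x y hxy [n _ Fnx]; exists n => //; exact: sF Fnx.
Qed.

Section NaturalFiltration.
Context d (O : measurableType d) d' (E : measurableType d').
Variable (Y : nat -> O -> E).

Lemma natural_filtration_salg t : sigma_algebra setT (natural_filtration Y t).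
Proof. exact: smallest_sigma_algebra. Qed.

Lemma natural_filtration_event s t B : (s < t)%N -> measurable B ->
  natural_filtration Y t (Y s.+1 @^-1` B).
Proof.
move=> st mB; apply: sub_sigma_algebra => /=.
rewrite -bigcup_seq/=; exists (Ordinal st); first by rewrite /= mem_index_enum.
by exists B => //; rewrite setTI.
Qed.

Lemma natural_filtration_sub t (C : set (set O)) : sigma_algebra setT C ->
  (forall s B, (s < t)%N -> measurable B -> C (Y s.+1 @^-1` B)) ->
  natural_filtration Y t `<=` C.
Proof.
move=> sC HC; apply: smallest_sub => // A.
rewrite -bigcup_seq => -[i _ [B mB <-]]; rewrite setTI; exact: HC.
Qed.

Lemma natural_filtration_mono s t : (s <= t)%N ->
  natural_filtration Y s `<=` natural_filtration Y t.
Proof.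
move=> st; apply: natural_filtration_sub; first exact: natural_filtration_salg.
by move=> r B rs mB; apply: natural_filtration_event => //; exact: leq_trans st.
Qed.

Lemma natural_filtration_resolved t (K : eqType) (h : O -> K) :
  (forall e : E, measurable [set e]) ->
  (forall s, (s < t)%N -> measurable_fun setT (Y s.+1)) ->
  (forall x y, h x = h y <-> forall s, (s < t)%N -> Y s.+1 x = Y s.+1 y) ->
  resolved (natural_filtration Y t) h.
Proof.
move=> mE mY hY; split.
- exact: natural_filtration_salg.
- apply: natural_filtration_sub; first exact: sigma_algebra_measurable.
  by move=> s B st mB; rewrite -[_ @^-1` _]setTI; exact: mY.
- move=> G x y /(natural_filtration_sub (saturated_salg h)).
  apply => s B st mB u v huv /=; have/hY := huv.
  by move=> /(_ s st) ->.
- move=> y; rewrite (_ : [set x | _] =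
     [set x | forall s, s \in iota 0 t -> (Y s.+1 @^-1` [set Y s.+1 y]) x]).
    apply: salg_bigcap; first exact: natural_filtration_salg.
    by move=> s; rewrite mem_iota add0n => /andP[_ st]; exact: natural_filtration_event.
  apply/seteqP; split=> x /= => [/hY xy s|xy].
    by rewrite mem_iota add0n => /andP[_ st]; exact: xy.
  by apply/hY => s st; apply: xy; rewrite mem_iota add0n.
Qed.

End NaturalFiltration.

Lemma measurable_set1_tuple d (E : measurableType d) n :
  (forall e : E, measurable [set e]) -> forall x : n.-tuple E, measurable [set x].
Proof.
move=> mE x; rewrite (_ : [set x] =
   [set y | forall i, i \in enum 'I_n -> (@tnth n E ^~ i @^-1` [set tnth x i]) y]).
  apply: salg_bigcap; first exact: sigma_algebra_measurable.
  move=> i _; rewrite -[_ @^-1` _]setTI; exact: measurable_tnth.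
apply/seteqP; split=> [y -> //|y /= xy].
by apply: eq_from_tnth => i; apply: xy; rewrite mem_enum.
Qed.

Section Paths.
Context {R : realType} {T : nat}.

Lemma measurable_set1_path (x : T.-tuple R) : measurable [set x].
Proof. by apply: measurable_set1_tuple => e; exact: measurable_set1. Qed.

Lemma measurable_path_coord t : measurable_fun setT (@path_coord R T t).
Proof.
rewrite /path_coord; have [tT|tT] := ltnP t.-1 T.
  rewrite (_ : (fun _ => _) = @tnth T R ^~ (Ordinal tT)).
    exact: measurable_tnth.
  by apply/funext => x; rewrite (tnth_nth 0).
rewrite (_ : (fun _ => _) = cst 0); first exact: measurable_cst.
by apply/funext => x; rewrite nth_default// size_tuple.
Qed.

Lemma take_pathP t (x y : T.-tuple R) : take t x = take t y <->
  forall s, (s < t)%N -> path_coord s.+1 x = path_coord s.+1 y.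
Proof.
rewrite /path_coord/=; split=> [xy s st|xy].
  by rewrite -(nth_take _ st) xy nth_take.
apply: (@eq_from_nth _ 0); first by rewrite !size_take !size_tuple.
move=> s; rewrite size_take_min leq_min => /andP[st _].
by rewrite !nth_take// xy.
Qed.

Lemma asset_filtration_resolved t :
  resolved (@asset_filtration R T t) (fun x => take t x).
Proof.
apply: natural_filtration_resolved => [e|s _|]; first exact: measurable_set1.
  exact: measurable_path_coord.
exact: take_pathP.
Qed.

Context {N : nat}.
Local Notation paths := (N.-tuple (T.-tuple R)).

Lemma measurable_set1_paths (x : paths) : measurable [set x].
Proof. by apply: measurable_set1_tuple; exact: measurable_set1_path. Qed.

Lemma measurable_coord_of i t : measurable_fun setT (@coord_of R T N i t).
Proof.
apply: (measurableT_comp (measurable_path_coord t)); exact: measurable_tnth.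
Qed.

Definition joint_hist (t : nat) (x : paths) : seq (seq R) :=
  [seq take t (tnth x i) | i <- enum 'I_N].

Lemma joint_histP t (x y : paths) :
  joint_hist t x = joint_hist t y <->
  forall i, take t (tnth x i) = take t (tnth y i).
Proof.
rewrite /joint_hist; split=> [xy i|xy].
  by have/eq_in_map/(_ i) := xy; rewrite mem_enum; exact.
by apply/eq_map => i; exact: xy.
Qed.

Lemma coord_filtration_resolved i t :
  resolved (natural_filtration (@coord_of R T N i) t)
    (fun x => take t (tnth x i)).
Proof.
apply: natural_filtration_resolved => [e|s _|x y]; first exact: measurable_set1.
  exact: measurable_coord_of.
exact: take_pathP.
Qed.

Lemma joint_filtration_resolved t :
  resolved (@joint_filtration R T N t) (joint_hist t).
Proof.
apply: natural_filtration_resolved => [e|s _|x y].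
- by apply: measurable_set1_tuple => ?; exact: measurable_set1.
- apply/measurable_fun_tnthP => i.
  rewrite (_ : _ \o _ = coord_of i s.+1); first exact: measurable_coord_of.
  by apply/funext => x /=; rewrite tnth_mktuple.
rewrite joint_histP; split=> [xy s st|xy i].
  apply: eq_from_tnth => i; rewrite !tnth_mktuple /coord_of.
  exact: (take_pathP t (tnth x i) (tnth y i)).1.
apply/take_pathP => s st; have := congr1 (@tnth _ _ ^~ i) (xy s st).
by rewrite /= !tnth_mktuple.
Qed.

(** The entry [i] is blanked and not removed, so that positions still match
assets. *)
Definition others_hist (i : 'I_N) (t : nat) (x : paths) : seq (seq R) :=
  [seq if j == i then [::] else take t (tnth x j) | j <- enum 'I_N].

Lemma others_histP i t (x y : paths) :
  others_hist i t x = others_hist i t y <->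
  forall j, j != i -> take t (tnth x j) = take t (tnth y j).
Proof.
rewrite /others_hist; split=> [xy j ji|xy].
  have/eq_in_map/(_ j) := xy; rewrite mem_enum (negbTE ji); exact.
by apply/eq_map => j; case: eqP => // /eqP; exact: xy.
Qed.

Lemma others_filtration_resolved i t :
  resolved (@others_filtration R T N i t) (others_hist i t).
Proof.
split.
- exact: smallest_sigma_algebra.
- apply: smallest_sub; first exact: sigma_algebra_measurable.
  by move=> A [j _]; apply: resolved_measurable; exact: coord_filtration_resolved.
- move=> G x y OG; move: G OG x y; apply: smallest_sub.
    exact: (saturated_salg (others_hist i t)).
  move=> A [j /= ji jA] x y /others_histP xy.
  exact: (resolved_saturated (coord_filtration_resolved j t) jA (xy _ ji)).
- move=> y; rewrite (_ : [set x | _] = [set x | forall j,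
     j \in [seq j <- enum 'I_N | j != i] ->
     [set x : paths | take t (tnth x j) = take t (tnth y j)] x]).
    apply: salg_bigcap; first exact: smallest_sigma_algebra.
    move=> j; rewrite mem_filter => /andP[ji _]; apply: sub_sigma_algebra.
    exists j => //=.
    exact: (resolved_atom (coord_filtration_resolved j t)).
  apply/seteqP; split=> x /= => [/others_histP xy j|xy].
    by rewrite mem_filter => /andP[ji _]; exact: xy.
  by apply/others_histP => j ji; apply: xy; rewrite mem_filter ji mem_enum.
Qed.

End Paths.

(** * A complete market is finitely supported *)

Lemma sum_pred1 (R : nmodType) (I : eqType) (s : seq I) (i : I) (f : I -> R) :
  uniq s -> i \in s -> \sum_(j <- s | j == i) f j = f i.
Proof. by move=> us si; rewrite -big_filter filter_pred1_uniq// big_seq1. Qed.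

Section HistoryMass.
Context {R : realType} {T : nat}.
Implicit Types (w : T.-tuple R -> R) (L : seq (T.-tuple R)).

Definition hist_mass w L (t : nat) (z : T.-tuple R) : R :=
  \sum_(y <- L | take t y == take t z) w y.

Lemma hist_mass_gt0 w L t z : (forall y, y \in L -> 0 < w y) -> z \in L ->
  0 < hist_mass w L t z.
Proof.
move=> w0 zL; rewrite /hist_mass big_seq_cond (big_rem z)//= zL eqxx/=.
rewrite ltr_pwDl ?w0// sumr_ge0// => y /andP[yL _]; exact/ltW/w0.
Qed.

Lemma hist_mass_terminal w L z : uniq L -> z \in L -> hist_mass w L T z = w z.
Proof.
move=> uL zL; rewrite -[RHS](sum_pred1 w uL zL); apply: eq_bigl => y.
by rewrite !take_oversize ?size_tuple.
Qed.

End HistoryMass.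

Lemma integral0_ae_eq0 d (O : measurableType d) (R : realType)
    (mu : probability O R) (A : set O) (f : O -> R) :
  measurable A -> measurable_fun setT f ->
  (\int[mu]_(x in A) (f x)%:E = 0)%E ->
  {ae mu, forall x, A x -> 0 <= f x} -> {ae mu, forall x, A x -> f x = 0}.
Proof.
move=> mA mf If0 f0.
have mfA : measurable_fun A (EFin \o f).
  by apply/measurable_EFinP; exact: measurable_funS mf.
have : ae_eq mu A (EFin \o f) (cst 0%E).
  apply/ae_eq_integral_abs => //; rewrite -[RHS]If0.
  apply: ae_eq_integral => //.
    by apply: measurableT_comp.
  apply: filterS f0 => x f0 Ax /=.
  by rewrite ger0_norm// f0.
by apply: filterS => x /[apply] -[].
Qed.

Section CompleteMarket.
Context {R : realType} {T : nat}.
Variable mu : probability (T.-tuple R) R.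
Local Notation F := (@asset_filtration R T).
Local Notation X := (asset mu).

Definition hist_event (t : nat) (y : T.-tuple R) : set (T.-tuple R) :=
  [set x : T.-tuple R | take t x = take t y].

Lemma asset_filtration_measurable t A : F t A -> measurable A.
Proof. exact: (resolved_measurable (asset_filtration_resolved t)). Qed.

Lemma asset_filtration_hist s t y : (s <= t)%N -> F t (hist_event s y).
Proof.
move=> st; apply: (natural_filtration_mono st).
exact: (resolved_atom (asset_filtration_resolved s)).
Qed.

Lemma measurable_hist t y : measurable (hist_event t y).
Proof. exact: (asset_filtration_measurable (asset_filtration_hist y (leqnn t))). Qed.

Lemma take_le s t (x y : seq R) :
  (s <= t)%N -> take t x = take t y -> take s x = take s y.
Proof.
by move=> st xy; rewrite -(take_takel x st) -(take_takel y st) xy.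
Qed.

Lemma asset_hist t (x y : T.-tuple R) : take t x = take t y -> X t x = X t y.
Proof.
by case: t => [//|t] /take_pathP; apply.
Qed.

Lemma measurable_asset t : measurable_fun setT (X t).
Proof.
case: t => [|t]; first exact: measurable_cst.
exact: measurable_path_coord.
Qed.

(** The conditional probabilities of [B]. Up to time [t] they vanish off the atom
of [y], which contains [B], and are a quotient of two probabilities on it;
afterwards [B] is decided. *)
Definition event_martingale (t : nat) (y : T.-tuple R) (B : set (T.-tuple R))
    (s : nat) (x : T.-tuple R) : R :=
  if (s <= t)%N then fine (mu B) / fine (mu (hist_event s y)) *
    \1_(hist_event s y) x else \1_B x.

Section EventMartingale.
Variables (t : nat) (y : T.-tuple R) (B : set (T.-tuple R)).
Hypotheses (FB : F t.+1 B) (By : B `<=` hist_event t y).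
Hypothesis (y0 : mu (hist_event t y) != 0%E).
Local Notation M := (event_martingale t y B).

Let mB : measurable B. Proof. exact: asset_filtration_measurable FB. Qed.

Let hist_sub s : (s <= t)%N -> hist_event t y `<=` hist_event s y.
Proof. by move=> st x; exact: take_le. Qed.

Let hist0 s : (s <= t)%N -> fine (mu (hist_event s y)) != 0.
Proof.
move=> st; rewrite fine_eq0 ?fin_num_measure//; last exact: measurable_hist.
apply: contra y0 => /eqP s0; rewrite -measure_le0 -[leRHS]s0 le_measure ?inE//.
- exact: measurable_hist.
- exact: measurable_hist.
- exact: hist_sub.
Qed.

Lemma event_martingale_wrt s : measurable_wrt (F s) (M s).
Proof.
rewrite /event_martingale; case: leqP => st.
  apply: (measurable_wrt_indic (asset_filtration_resolved s)
    (fun b : bool => fine (mu B) / fine (mu (hist_event s y)) * b%:R)).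
  exact: asset_filtration_hist.
apply: (measurable_wrt_indic (asset_filtration_resolved s)
  (fun b : bool => b%:R : R) (A := B)).
exact: natural_filtration_mono FB.
Qed.

(** For [s <= t], an event of [F s] either contains the atom of [y] or is disjoint
from it, so that both sides are [mu B] or both are 0. *)
Lemma event_martingale_integral s G : F s G ->
  (\int[mu]_(x in G) (M s x)%:E = mu (B `&` G))%E.
Proof.
move=> FG; have mG := asset_filtration_measurable FG.
rewrite /event_martingale; case: leqP => st; last by rewrite integral_indic.
have mH := measurable_hist s y.
under eq_integral do rewrite EFinM.
rewrite integralZl//; last by apply: integrableS (integrable_indic _ _).
rewrite integral_indic//.
have sG (u v : T.-tuple R) : take s u = take s v -> G u -> G v.
  exact: (resolved_saturated (asset_filtration_resolved s) FG).
have [Gy|Gy] := pselect (G y).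
  rewrite !setIidl.
  - rewrite -[X in (_ * X)%E]fineK ?fin_num_measure//.
    by rewrite -EFinM divfK ?hist0// fineK// fin_num_measure.
  - by move=> x /By /(hist_sub st) /esym yx; exact: (sG _ _ yx Gy).
  - by move=> x /esym yx; exact: (sG _ _ yx Gy).
rewrite (_ : hist_event s y `&` G = set0); last first.
  by apply/seteqP; split=> // x [yx Gx]; apply: Gy; exact: (sG _ _ yx Gx).
rewrite (_ : B `&` G = set0); last first.
  apply/seteqP; split=> // x [/By/(hist_sub st) yx Gx].
  by apply: Gy; exact: (sG _ _ yx Gx).
by rewrite measure0 mule0.
Qed.

Lemma event_martingale_integrable s : mu.-integrable setT (EFin \o M s).
Proof.
rewrite /event_martingale; case: leqP => st; last exact: integrable_indic.
rewrite (_ : _ \o _ = fun x => ((fine (mu B) / fine (mu (hist_event s y)))%:E *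
  (\1_(hist_event s y) x)%:E)%E)//.
apply: integrableZl => //; apply: integrable_indic; exact: measurable_hist.
Qed.

Lemma event_martingaleP : martingale mu F T M.
Proof.
split=> [s _|s _|s s' /andP[ss' _]].
- exact: event_martingale_wrt.
- exact: event_martingale_integrable.
- split=> [||G FG]; first exact: event_martingale_wrt.
    exact: event_martingale_integrable.
  rewrite !event_martingale_integral//.
  exact: natural_filtration_mono FG.
Qed.

Lemma event_replication : complete_market mu -> (0 < T)%N ->
  exists Delta : nat -> T.-tuple R -> R,
    (forall s, (s < T)%N -> measurable_wrt (F s) (Delta s)) /\
    (forall s, (s <= T)%N -> {ae mu, forall x, M s x = fine (mu B) +
       \sum_(r < s) Delta r x * (X r.+1 x - X r x)}).
Proof.
move=> hc T0; have [Delta [mD DE]] := hc _ event_martingaleP.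
exists Delta; split => // s sT; have := DE s sT.
rewrite unlock event_martingale_integral ?setIT//.
exact: (salgT (natural_filtration_salg _ _)).
Qed.

End EventMartingale.

Hypothesis T0 : (0 < T)%N.
Hypothesis hmart : martingale mu F T X.
Hypothesis hcompl : complete_market mu.

Lemma asset_increment_integrable t : (t < T)%N ->
  mu.-integrable setT (fun x => (X t.+1 x - X t x)%:E).
Proof.
move=> tT; have [_ Xint _] := hmart.
apply: (@eq_integrable _ _ _ _ _ measurableT
  ((EFin \o X t.+1) \- (EFin \o X t))%E) => [x _|].
  by rewrite /= EFinB.
by apply: integrableB => //; apply: Xint => //; exact: ltnW.
Qed.

Lemma asset_increment_integral t y : (t < T)%N ->
  (\int[mu]_(x in hist_event t y) (X t.+1 x - X t x)%:E = 0)%E.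
Proof.
move=> tT; have [_ Xint XE] := hmart.
have mH := measurable_hist t y.
have iX s : (s <= T)%N -> mu.-integrable (hist_event t y) (EFin \o X s).
  by move=> sT; apply: integrableS (Xint s sT).
under eq_integral do rewrite EFinB.
rewrite integralB_EFin//; [|exact: iX|exact/iX/ltnW].
have [_ _ ->] := XE t t.+1 ltac:(by rewrite leqnSn).
  rewrite subee//; apply: integrable_fin_num => //; exact: iX.
exact: asset_filtration_hist.
Qed.

(** On the atom of [y], the replication of the event that the next price exceeds
the current price [c] makes the indicator of that event an affine function of
the next price. With nonzero slope the two values of the indicator leave two
prices. With slope 0 the price moves in one direction only, hence not at all,
since its increment has mean 0. *)
Lemma binary_branching t (y : T.-tuple R) : (t < T)%N -> exists v : R * R,
  {ae mu, forall x : T.-tuple R, take t x = take t y ->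
     path_coord t.+1 x = v.1 \/ path_coord t.+1 x = v.2}.
Proof.
move=> tT; have mH := measurable_hist t y.
have [y0|y0] := eqVneq (mu (hist_event t y)) 0%E.
  exists (0, 0), (hist_event t y); split => // x /= /not_implyP[]//.
pose c := X t y.
pose B := hist_event t y `&` path_coord t.+1 @^-1` `]c, +oo[.
have FB : F t.+1 B.
  apply: (salgI (natural_filtration_salg _ _)).
    exact: asset_filtration_hist.
  by apply: natural_filtration_event => //; exact: measurable_itv.
have [Delta [mD /(_ t.+1 tT) DE]] :=
  event_replication FB (@subIsetl _ _ _) y0 hcompl T0.
(* the part of the replication that is constant on the atom *)
pose K := fine (mu B) + \sum_(r < t) Delta r y * (X r.+1 y - X r y).
have {}DE : {ae mu, forall x, hist_event t y x ->
    \1_B x = K + Delta t y * (path_coord t.+1 x - c)}.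
  apply: filterS DE => x; rewrite /event_martingale ltnn => -> xy.
  have Deq r : (r <= t)%N -> Delta r x = Delta r y.
    move=> rt; apply: (measurable_wrt_eq (asset_filtration_resolved r)).
    - by move=> e; exact: measurable_set1.
    - by apply: mD; exact: leq_ltn_trans tT.
    - exact: take_le xy.
  rewrite big_ord_recr/= addrA (asset_hist xy) Deq//; congr (_ + _ + _).
  apply: eq_bigr => -[r rt] _ /=; rewrite Deq//; last exact: ltnW.
  by rewrite (asset_hist (take_le rt xy)) (asset_hist (take_le (ltnW rt) xy)).
have [D0|D0] := eqVneq (Delta t y) 0; last first.
  exists (c - K / Delta t y, c + (1 - K) / Delta t y).
  apply: filterS DE => x /[apply]; rewrite indicE.
  case: (x \in B) => /= xE; [right|left].
    have -> : 1 - K = Delta t y * (path_coord t.+1 x - c).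
      by rewrite -[X in X - _]/(true%:R) xE addrC addKr.
    by rewrite mulrAC mulfV// mul1r addrC subrK.
  have -> : K = - (Delta t y * (path_coord t.+1 x - c)).
    by apply/eqP; rewrite -addr_eq0; apply/eqP; rewrite -xE.
  by rewrite mulNr opprK mulrAC mulfV// mul1r addrC subrK.
exists (c, c); pose f x := X t.+1 x - X t x.
have mf : measurable_fun setT f by apply: measurable_funB; exact: measurable_asset.
have fE x : hist_event t y x -> f x = path_coord t.+1 x - c.
  by move=> xy; rewrite /f (asset_hist xy).
have If := asset_increment_integral y tT.
suff : {ae mu, forall x, hist_event t y x -> f x = 0}.
  apply: filterS => x /[swap] xy /(_ xy); rewrite fE// => /eqP.
  by rewrite subr_eq0 => /eqP; left.
have BE x : hist_event t y x -> (x \in B) = (c < path_coord t.+1 x).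
  move=> xy; apply/idP/idP => [/set_mem[_]|cx].
    by rewrite /= in_itv/= andbT.
  by apply/mem_set; split => //=; rewrite in_itv/= andbT.
have [K0|K0] := eqVneq K 0.
  have : {ae mu, forall x, hist_event t y x -> - f x = 0}.
    apply: integral0_ae_eq0 => //; first exact: measurableT_comp.
      transitivity (\int[mu]_(x in hist_event t y) ((-1)%:E * (f x)%:E))%E.
        by apply: eq_integral => x _; rewrite -EFinM mulN1r.
      rewrite integralZl ?If ?mule0//.
      by apply: integrableS (asset_increment_integrable tT).
    apply: filterS DE => x /[swap] xy /(_ xy); rewrite indicE BE// D0 mul0r addr0 K0.
    rewrite oppr_ge0 fE// subr_le0; case: ltP => //= _ /eqP.
    by rewrite oner_eq0.
  by apply: filterS => x /[apply] /eqP; rewrite oppr_eq0 => /eqP.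
apply: integral0_ae_eq0 => //.
apply: filterS DE => x /[swap] xy /(_ xy); rewrite indicE BE// D0 mul0r addr0.
rewrite fE// subr_ge0; case: ltP => /= [/ltW//|_ K00].
by rewrite -K00 eqxx in K0.
Qed.

Lemma finite_histories t : (t <= T)%N -> exists L : seq (seq R),
  {ae mu, forall x : T.-tuple R, take t x \in L}.
Proof.
elim: t => [_|t IHt tT].
  by exists [:: [::]]; apply: aeW => x; rewrite take0 inE.
have [L LE] := IHt (ltnW tT).
have /choice[v vE] (h : seq R) : exists v : R * R,
    {ae mu, forall x : T.-tuple R, take t x = h ->
      path_coord t.+1 x = v.1 \/ path_coord t.+1 x = v.2}.
  have [[y yh]|nh] := pselect (exists y : T.-tuple R, take t y = h).
    by rewrite -yh; exact: binary_branching.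
  by exists (0, 0); apply: aeW => x xh; case: nh; exists x.
exists (flatten [seq [:: rcons h (v h).1; rcons h (v h).2] | h <- L]).
have /ae_foralln VE n := vE (nth [::] L n).
apply: filterS2 LE VE => x xL xV; apply/flatten_mapP; exists (take t x) => //.
have := xV (index (take t x) L); rewrite nth_index// => /(_ erefl).
rewrite (take_nth 0) ?size_tuple// /path_coord/= !inE.
by case=> ->; rewrite eqxx ?orbT.
Qed.

Lemma complete_market_finite_support : exists L : seq (T.-tuple R),
  [/\ uniq L, supported mu L & forall z, z \in L -> 0 < mass mu z].
Proof.
have [L0 L0E] := finite_histories (leqnn T).
pose L1 : seq (T.-tuple R) := undup (pmap insub L0).
have L1s : supported mu L1.
  apply: (ae_mem_supported measurable_set1_path); apply: filterS L0E => x xL0.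
  rewrite mem_undup mem_pmap; apply/mapP; exists (x : seq R).
    by rewrite take_oversize ?size_tuple in xL0.
  by rewrite valK.
exists [seq z <- L1 | 0 < mass mu z]; split.
- by rewrite filter_uniq// undup_uniq.
- apply: (ae_mem_supported measurable_set1_path).
  apply: (ae_supported measurable_set1_path (undup_uniq _) L1s) => x.
  by rewrite mem_filter => -> ->.
- by move=> z; rewrite mem_filter => /andP[].
Qed.

Section FiniteModel.
Variable L : seq (T.-tuple R).
Hypotheses (uL : uniq L) (sL : supported mu L).
Hypothesis posL : forall z, z \in L -> 0 < mass mu z.

Lemma sum_hist (f : T.-tuple R -> R) t (y : T.-tuple R) :
  \sum_(z <- L | take t z == take t y) f z =
  \sum_(z <- L) \1_(hist_event t y) z * f z.
Proof.
rewrite big_mkcond; apply: eq_bigr => z _; rewrite indicE.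
by case: eqP => zy; [rewrite mem_set// mul1r|rewrite memNset// mul0r].
Qed.

Lemma measure_hist t (y : T.-tuple R) :
  mu (hist_event t y) = (hist_mass (mass mu) L t y)%:E.
Proof.
rewrite /hist_mass.
rewrite (measure_supported measurable_set1_path uL sL (measurable_hist t y)).
by rewrite sum_hist; congr EFin; apply: eq_bigr => z _; rewrite mulrC.
Qed.

Lemma finite_martingale t (y : T.-tuple R) : (t < T)%N ->
  \sum_(z <- L | take t z == take t y) mass mu z * (X t.+1 z - X t z) = 0.
Proof.
move=> tT; have := asset_increment_integral y tT.
rewrite (integral_supported measurable_set1_path uL sL)//; last 2 first.
- by apply: measurable_funB; exact: measurable_asset.
- exact: measurable_hist.
by move=> /(congr1 fine)/= sE; rewrite sum_hist -[RHS]sE;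
   apply: eq_bigr => z _; rewrite mulrCA.
Qed.

(** A single path [z] is an event inside the atom of its history at the last date
before [T]; the left-hand side is its conditional probability at time [t] on
the path [x]. *)
Lemma finite_replication z : z \in L ->
  exists Delta : nat -> T.-tuple R -> R,
    (forall t (x y : T.-tuple R), (t < T)%N -> take t x = take t y ->
       Delta t x = Delta t y) /\
    (forall t x, (t <= T)%N -> x \in L ->
      mass mu z / hist_mass (mass mu) L t z * (take t x == take t z)%:R =
      mass mu z + \sum_(s < t) Delta s x * (X s.+1 x - X s x)).
Proof.
move=> zL; have mz := measurable_set1_path z.
have [t TE] : exists t, T = t.+1 by exists T.-1; rewrite prednK.
have takeT (x : T.-tuple R) : take t.+1 x = x.
  by rewrite take_oversize// size_tuple TE.
have zhist : [set z] = hist_event t.+1 z.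
  by apply/seteqP; split => [x ->//|x]; rewrite /hist_event/= !takeT => /val_inj.
have Fz : F t.+1 [set z] by rewrite zhist; exact: asset_filtration_hist.
have zsub : [set z] `<=` hist_event t z by move=> x ->.
have z0 : mu (hist_event t z) != 0%E.
  apply/eqP => H0.
  have : (mu [set z] <= mu (hist_event t z))%E.
    by rewrite le_measure ?inE//; exact: measurable_hist.
  by rewrite H0 (massE measurable_set1_path) lee_fin leNgt posL.
have [Delta [mD DE]] := event_replication Fz zsub z0 hcompl T0.
exists Delta; split => [s x y sT|s x sT xL].
  apply: (measurable_wrt_eq (asset_filtration_resolved s)); last exact: mD.
  by move=> e; exact: measurable_set1.
have := ae_supportedE measurable_set1_path (posL xL) (DE s sT).
rewrite -[fine _]/(mass mu z) => <-; rewrite /event_martingale measure_hist/=.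
rewrite -[fine _]/(mass mu z) indicE.
have -> : (x \in hist_event s z) = (take s x == take s z).
  by apply/idP/eqP => [/set_mem//|xz]; apply/mem_set.
case: leqP => // ts; have -> : s = t.+1 by apply/eqP; rewrite eqn_leq ts -TE sT.
rewrite zhist indicE.
have -> : (x \in hist_event t.+1 z) = (x == z).
  by rewrite -zhist; apply/idP/eqP => [/set_mem//|xz]; apply/mem_set.
rewrite !takeT (inj_eq val_inj); case: eqP => [_|_]; last by rewrite mulr0.
by rewrite mulr1 -TE hist_mass_terminal// divff// gt_eqF// posL.
Qed.

End FiniteModel.

End CompleteMarket.

(** * Couplings of finite markets *)

(** Dividing by the number [n] of points of [S] in a fibre and summing over all of
them replaces a choice of one representative per fibre. *)
Lemma sum_fibres (R : realFieldType) (O K : eqType) (S : seq O) (k : O -> K)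
    (phi c : O -> R) :
  (forall y, y \in S -> \sum_(x <- S | k x == k y) c x = 0) ->
  (forall x y, x \in S -> y \in S -> k x = k y -> phi x = phi y) ->
  \sum_(x <- S) phi x * c x = 0.
Proof.
move=> c0 phik; pose n x : R := \sum_(y <- S) (k x == k y)%:R.
have n0 x : x \in S -> n x != 0.
  move=> xS; rewrite gt_eqF// /n (big_rem x)//= eqxx ltr_pwDl//.
  by rewrite sumr_ge0.
transitivity (\sum_(x <- S) \sum_(y <- S) (k x == k y)%:R * (phi x * c x / n x)).
  apply: eq_big_seq => x xS; rewrite -big_distrl/= -/(n x).
  by rewrite [RHS]mulrC divfK// n0.
rewrite exchange_big/=; apply: big1_seq => y /andP[_ yS].
transitivity (phi y / n y * \sum_(x <- S | k x == k y) c x); last first.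
  by rewrite c0// mulr0.
rewrite big_distrr/= [RHS]big_mkcond/=; apply: eq_big_seq => x xS.
case: eqP => [kxy|_]; last by rewrite mul0r.
rewrite mul1r (phik _ _ xS yS kxy).
have -> : n x = n y by apply: eq_bigr => u _; rewrite kxy.
ring.
Qed.

Section Coupling.
Context {R : realType} {T N : nat}.
Local Notation path := (T.-tuple R).
Local Notation paths := (N.-tuple (T.-tuple R)).

Lemma joint_hist_le s t (x y : paths) : (s <= t)%N ->
  joint_hist t x = joint_hist t y -> joint_hist s x = joint_hist s y.
Proof.
move=> st /joint_histP xy; apply/joint_histP => i; exact: take_le st _.
Qed.

(** Finite complete markets, one for each asset: [w i z] is the probability of the
path [z], [a i t z] its price at time [t], and the conditional probabilities of
each path are the values of a trading strategy. *)
Variables (w : 'I_N -> path -> R) (L : 'I_N -> seq path).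
Variable a : 'I_N -> nat -> path -> R.
Hypothesis uL : forall i, uniq (L i).
Hypothesis w_gt0 : forall i z, z \in L i -> 0 < w i z.
Hypothesis w_sum1 : forall i, \sum_(z <- L i) w i z = 1.
Hypothesis w_mart : forall i t (y : path), (t < T)%N ->
  \sum_(z <- L i | take t z == take t y) w i z * (a i t.+1 z - a i t z) = 0.
Local Notation W i t z := (hist_mass (w i) (L i) t z).
Hypothesis w_repl : forall i z, z \in L i ->
  exists Delta : nat -> path -> R,
    (forall t (x y : path), (t < T)%N -> take t x = take t y ->
       Delta t x = Delta t y) /\
    (forall t x, (t <= T)%N -> x \in L i ->
      w i z / W i t z * (take t x == take t z)%:R =
      w i z + \sum_(s < t) Delta s x * (a i s.+1 x - a i s x)).

Variable S : seq paths.
Hypothesis uS : uniq S.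
Hypothesis memS : forall x, x \in S <-> forall i, tnth x i \in L i.
Hypothesis sumS : forall F : 'I_N -> path -> R,
  \sum_(x <- S) \prod_i F i (tnth x i) = \prod_i \sum_(z <- L i) F i z.

Definition increment i t (x : paths) : R := a i t.+1 (tnth x i) - a i t (tnth x i).

Definition adapted t (phi : paths -> R) := forall x y, x \in S -> y \in S ->
  joint_hist t x = joint_hist t y -> phi x = phi y.

Definition martingale_mass (p : paths -> R) := forall i t y, (t < T)%N -> y \in S ->
  \sum_(x <- S | joint_hist t x == joint_hist t y) p x * increment i t x = 0.

(** With [phi] the indicator of an atom of the joint history up to [t]: given that
atom, the path [z] of asset [i] has conditional probability [w i z / W i t z],
the one given the history of asset [i] alone. It is a product formula because
atoms may be null for [p]. *)
Definition causal_mass (p : paths -> R) := forall i t z phi,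
  (t <= T)%N -> z \in L i -> adapted t phi ->
  W i t z * (\sum_(x <- S | tnth x i == z) p x * phi x) =
  w i z * (\sum_(x <- S | take t (tnth x i) == take t z) p x * phi x).

Let W_gt0 i t z : z \in L i -> 0 < W i t z.
Proof. by move=> zL; apply: hist_mass_gt0 => // y; exact: w_gt0. Qed.

Let W_eq i t (y z : path) : take t y = take t z -> W i t y = W i t z.
Proof. by move=> yz; rewrite /hist_mass yz. Qed.

Lemma sum_coord i (alpha : path -> R) (G : paths -> R) :
  \sum_(x <- S) alpha (tnth x i) * G x =
  \sum_(z <- L i) alpha z * \sum_(x <- S | tnth x i == z) G x.
Proof.
transitivity (\sum_(x <- S) \sum_(z <- L i | z == tnth x i) alpha z * G x).
  apply: eq_big_seq => x /memS /(_ i) xL.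
  by rewrite (sum_pred1 (fun z => alpha z * G x)).
rewrite (exchange_big_dep predT)//=; apply: eq_bigr => z _.
by rewrite big_distrr/=; apply: eq_bigl => x; rewrite eq_sym.
Qed.

(** The strategy that replicates the path [z] in market [i], scaled from time [t]
on by [phi], is adapted to the joint history. Its gains after [t] are centred
under [p], so the conditional probabilities [M s] of [z] keep the same mean
against [phi] from [s = t] to [s = T]. *)
Lemma martingale_causal_mass p : martingale_mass p -> causal_mass p.
Proof.
move=> pmart i t z phi tT zL aphi; have [Delta [aD DE]] := w_repl zL.
pose M s x : R := w i z / W i s z * (take s (tnth x i : path) == take s z)%:R.
have step s : (t <= s < T)%N ->
    \sum_(x <- S) p x * phi x * M s.+1 x = \sum_(x <- S) p x * phi x * M s x.
  move=> /andP[ts sT]; apply/eqP; rewrite -subr_eq0 -sumrB; apply/eqP.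
  rewrite -[RHS](@sum_fibres _ _ _ S (joint_hist s)
    (fun x => phi x * Delta s (tnth x i)) (fun x => p x * increment i s x)).
  - apply: eq_big_seq => x /memS/(_ i) xL.
    by rewrite -mulrBr /M !DE// 1?ltnW// big_ord_recr/= /increment; ring.
  - by move=> y; exact: pmart.
  - move=> x y xS yS xy; rewrite (aphi x y)//; last exact: joint_hist_le xy.
    by rewrite (aD s _ (tnth y i))//; move/joint_histP : xy.
have MT s : (t <= s <= T)%N ->
    \sum_(x <- S) p x * phi x * M s x = \sum_(x <- S) p x * phi x * M t x.
  elim: s => [|s IHs]; first by rewrite leqn0 => /andP[/eqP ->].
  move=> /andP[]; rewrite leq_eqVlt => /orP[/eqP -> //|ts sT].
  rewrite ltnS in ts; by rewrite step ?ts// IHs// ts ltnW.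
have := MT T; rewrite tT leqnn => /(_ isT).
have takeT (x : path) : take T x = x by rewrite take_oversize// size_tuple.
have -> : \sum_(x <- S) p x * phi x * M T x =
    \sum_(x <- S | tnth x i == z) p x * phi x.
  rewrite [RHS]big_mkcond/=; apply: eq_bigr => x _.
  have -> : M T x = (tnth x i == z)%:R.
    rewrite /M !takeT (inj_eq val_inj) hist_mass_terminal//.
    by rewrite divff ?mul1r// gt_eqF// w_gt0.
  by case: eqP; rewrite ?mulr1 ?mulr0.
move=> ->; rewrite [in RHS]big_mkcond/= !big_distrr/=; apply: eq_bigr => x _.
rewrite /M; case: eqP => _; last by rewrite !mulr0.
rewrite mulr1; field; rewrite gt_eqF// W_gt0//.
Qed.

(** The joint history predicts the path of asset [i] no better than its own
history does, given which its increment is centred under [w i]. *)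
Lemma causal_mass_increment p i t phi : causal_mass p -> (t < T)%N ->
  adapted t phi -> \sum_(x <- S) p x * phi x * increment i t x = 0.
Proof.
move=> pc tT aphi.
pose delta z := a i t.+1 z - a i t z.
transitivity (\sum_(x <- S) delta (tnth x i) * (p x * phi x)).
  by apply: eq_bigr => x _; rewrite mulrC.
rewrite (sum_coord i delta).
transitivity (\sum_(z <- L i) \sum_(x <- S | take t (tnth x i) == take t z)
    p x * phi x * (w i z * delta z / W i t (tnth x i))).
  apply: eq_big_seq => z zL.
  have -> : \sum_(x <- S | tnth x i == z) p x * phi x =
      w i z / W i t z * \sum_(x <- S | take t (tnth x i) == take t z) p x * phi x.
    by rewrite mulrAC -(pc _ _ _ _ (ltnW tT) zL aphi) mulrC mulKf// gt_eqF// W_gt0.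
  rewrite mulrA big_distrr/=; apply: eq_bigr => x /eqP xz.
  by rewrite (W_eq _ xz); ring.
rewrite (exchange_big_dep predT)//=; apply: big1 => x _.
rewrite -big_distrr/= -big_distrl/=.
have := w_mart i (tnth x i) tT; rewrite (eq_bigl _ _ (fun z => eq_sym _ _)) => ->.
by rewrite mul0r mulr0.
Qed.

Lemma causal_mass_marginal p i z : causal_mass p -> z \in L i ->
  \sum_(x <- S | tnth x i == z) p x = w i z * \sum_(x <- S) p x.
Proof.
move=> pc zL; have := pc i 0%N z (cst 1) (leq0n _) zL ltac:(by []).
have -> : W i 0 z = 1.
  by rewrite -(w_sum1 i); apply: eq_bigl => y; rewrite !take0 eqxx.
rewrite mul1r; under eq_bigr do rewrite mulr1.
move=> ->; congr (_ * _); under [LHS]eq_bigr do rewrite mulr1.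
by apply: eq_bigl => x; rewrite !take0 eqxx.
Qed.

Definition product_mass (x : paths) := \prod_i w i (tnth x i).

Lemma product_mass_sum1 : \sum_(x <- S) product_mass x = 1.
Proof. by rewrite sumS big1// => i _; exact: w_sum1. Qed.

(** The sum over [S] factorises over the assets, and the factor of asset [i] is the
martingale property of its own market. *)
Lemma product_mass_martingale : martingale_mass product_mass.
Proof.
move=> i t y tT yS.
pose F j z := w j z * (take t z == take t (tnth y j))%:R *
  (if j == i then a i t.+1 z - a i t z else 1).
transitivity (\sum_(x <- S) \prod_j F j (tnth x j)); last first.
  rewrite sumS (bigD1 i)//= (_ : \sum_(z <- L i) _ = 0) ?mul0r//.
  rewrite -[RHS](w_mart i (tnth y i) tT) [RHS]big_mkcond/=.
  apply: eq_bigr => z _; rewrite /F eqxx.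
  by case: (take t z == _); rewrite ?mulr0 ?mul0r ?mulr1.
rewrite big_mkcond/=; apply: eq_bigr => x _.
rewrite /F !big_split/=.
have -> : \prod_j (if j == i then
     a i t.+1 (tnth x j) - a i t (tnth x j) else 1) = increment i t x.
  by rewrite -big_mkcond/= big_pred1_eq.
have -> : \prod_j (take t (tnth x j) == take t (tnth y j))%:R =
    (joint_hist t x == joint_hist t y)%:R :> R.
  have [/joint_histP xy|xy] := eqVneq (joint_hist t x).
    by rewrite big1// => j _; rewrite xy eqxx.
  have [j xyj] : exists j, take t (tnth x j) != take t (tnth y j).
    apply: contrapT => Nxy; move/eqP: xy; apply; apply/joint_histP => j.
    by apply/eqP; apply: contrapT => /negP xyj; apply: Nxy; exists j.
  by rewrite (bigD1 j)//= (negbTE xyj) mul0r.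
by case: eqP => _; rewrite ?mulr1// mulr0 mul0r.
Qed.

End Coupling.

Lemma big_tuple_product (R : comNzRingType) (X : choiceType) N (L : 'I_N -> seq X) :
  (forall i, uniq (L i)) ->
  exists S : seq (N.-tuple X), [/\ uniq S,
    forall x, x \in S <-> forall i, tnth x i \in L i &
    forall F : 'I_N -> X -> R, \sum_(x <- S) \prod_i F i (tnth x i) =
      \prod_i \sum_(z <- L i) F i z].
Proof.
move=> uL.
(* All the [L i] are embedded in one finite type, whose finite functions serve
   to distribute the product over the sums. *)
pose Lc := undup (flatten [seq L i | i <- enum 'I_N]).
have LLc i z : z \in L i -> z \in Lc.
  move=> zL; rewrite mem_undup; apply/flatten_mapP; exists i => //.
  by rewrite mem_enum.
pose tup (f : {ffun 'I_N -> seq_sub Lc}) : N.-tuple X := [tuple val (f i) | i < N].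
have tupE f i : tnth (tup f) i = val (f i) by rewrite tnth_mktuple.
have tup_inj : injective tup.
  move=> f g fg; apply/ffunP => i; apply: val_inj.
  by rewrite -!tupE fg.
pose Q (f : {ffun 'I_N -> seq_sub Lc}) := [forall i, val (f i) \in L i].
exists [seq tup f | f <- enum Q]; split.
- by rewrite map_inj_uniq// enum_uniq.
- move=> x; split=> [/mapP[f]|xL].
    by rewrite mem_enum => /forallP fL -> i; rewrite tupE; exact: fL.
  apply/mapP; exists [ffun i => SeqSub (LLc i _ (xL i))].
    by rewrite mem_enum; apply/forallP => i; rewrite ffunE/=.
  by apply: eq_from_tnth => i; rewrite tupE ffunE.
- move=> F; rewrite big_map big_enum/=.
  transitivity (\prod_(i < N) \sum_(j : seq_sub Lc | val j \in L i) F i (val j)).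
    rewrite bigA_distr_big_dep.
    apply: eq_big => [f|f _]; last by apply: eq_bigr => i _; rewrite tupE.
    by apply/forallP/familyP.
  apply: eq_bigr => i _.
  rewrite -(big_map val (fun z => z \in L i) (F i)) -big_filter.
  apply: perm_big; apply: uniq_perm => //.
    by rewrite filter_uniq// map_inj_uniq ?index_enum_uniq//; exact: val_inj.
  move=> z; rewrite mem_filter; apply/andP/idP => [[]//|zL]; split=> //.
  by apply/mapP; exists (SeqSub (LLc _ _ zL)); rewrite ?mem_index_enum.
Qed.

(** * Multicausal couplings as mass functions *)

Section ConditionalExpectation.
Context {R : realType} d (O : measurableType d) (K : eqType).
Hypothesis mset1 : forall x : O, measurable [set x].
Variables (P : probability O R) (S : seq O) (H : set (set O)) (h : O -> K).
Hypotheses (uS : uniq S) (PS : supported P S) (rH : resolved H h).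

Definition fibre_mass (A : set O) (x : O) : R :=
  \sum_(y <- S | h y == h x) mass P y * \1_A y.

(** On a null fibre this is 0, a harmless value there. *)
Definition fibre_average (A : set O) (x : O) : R :=
  fibre_mass A x / fibre_mass setT x.

Lemma fibre_average_cond_expectation A : measurable A ->
  cond_expectation P H \1_A (fibre_average A).
Proof.
move=> mA; have wrt : measurable_wrt H (fibre_average A).
  apply: (@measurable_wrt_atoms _ O K H h rH _ R (fibre_average A) S 0) => [x y _ xy|x xS].
    by rewrite /fibre_average /fibre_mass xy.
  rewrite /fibre_average /fibre_mass big1_seq ?mul0r// => y /andP[/eqP yx yS].
  by have := xS y yS; rewrite yx eqxx.
have mf := measurable_wrt_measurable rH wrt.
split=> //; first exact: (integrable_supported mset1 uS PS).
move=> G HG; have mG := resolved_measurable rH HG.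
rewrite !(integral_supported mset1 uS PS)//; congr EFin.
apply/eqP; rewrite -subr_eq0 -sumrB; apply/eqP.
transitivity (\sum_(x <- S) \1_G x * (mass P x * (fibre_average A x - \1_A x))).
  by apply: eq_bigr => x _; ring.
apply: (@sum_fibres _ _ _ S h) => [y yS|x y _ _ xy]; last first.
  rewrite !indicE (_ : (x \in G) = (y \in G))//.
  apply/idP/idP => /set_mem Gx; apply/mem_set.
    exact: (resolved_saturated rH HG xy Gx).
  exact: (resolved_saturated rH HG (esym xy) Gx).
under eq_bigr do rewrite mulrBr.
rewrite sumrB -/(fibre_mass A y).
transitivity (fibre_average A y * fibre_mass setT y - fibre_mass A y).
  congr (_ - _); rewrite /fibre_mass big_distrr/=; apply: eq_bigr => x /eqP xy.
  by rewrite indicT mulr1 mulrC /fibre_average /fibre_mass xy.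
have [T0|T0] := eqVneq (fibre_mass setT y) 0; last first.
  by rewrite /fibre_average divfK// subrr.
rewrite T0 mulr0 sub0r /fibre_mass; apply/eqP; rewrite oppr_eq0; apply/eqP.
move/eqP: T0; rewrite /fibre_mass psumr_eq0 => [/allP T0|x _]; last first.
  by rewrite mulr_ge0// mass_ge0.
apply: big1_seq => x /andP[xy xS]; have := T0 x xS; rewrite xy/= indicT mulr1.
by move=> /eqP ->; rewrite mul0r.
Qed.

End ConditionalExpectation.

Section Transfer.
Context {R : realType} {T N : nat}.
Local Notation path := (T.-tuple R).
Local Notation paths := (N.-tuple (T.-tuple R)).
Variable mu : 'I_N -> probability path R.
Variables (L : 'I_N -> seq path) (S : seq paths).
Hypothesis uL : forall i, uniq (L i).
Hypothesis sL : forall i, supported (mu i) (L i).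
Hypothesis posL : forall i z, z \in L i -> 0 < mass (mu i) z.
Hypothesis uS : uniq S.
Hypothesis memS : forall x, x \in S <-> forall i, tnth x i \in L i.
Implicit Type pi : probability paths R.
Local Notation w := (fun i => mass (mu i)).

Local Notation W i t z := (hist_mass (mass (mu i)) (L i) t z).

Let W_gt0 i t z : z \in L i -> 0 < W i t z.
Proof. by move=> zL; apply: hist_mass_gt0 => // y; exact: posL. Qed.

Definition coord_event (i : 'I_N) (A : set path) : set paths :=
  (fun x => tnth x i) @^-1` A.

Lemma measurable_coord_event i A : measurable A -> measurable (coord_event i A).
Proof. by move=> mA; rewrite -[coord_event _ _]setTI; exact: measurable_tnth. Qed.

Lemma multicausal_supported pi : multicausal mu pi -> supported pi S.
Proof.
move=> [marg _]; apply: (ae_mem_supported measurable_set1_paths).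
have /ae_foralln SE (n : nat) :
    {ae pi, forall x, forall i : 'I_N, i = n :> nat -> tnth x i \in L i}.
  have [nN|nN] := ltnP n N; last first.
    by apply: aeW => x i iE; move: (ltn_ord i); rewrite iE ltnNge nN.
  have mL := measurableC (measurable_seq measurable_set1_path (L (Ordinal nN))).
  exists (coord_event (Ordinal nN) (~` [set` L (Ordinal nN)])); split.
  - exact: measurable_coord_event.
  - by rewrite marg//; exact: sL.
  - move=> x /= /existsNP[i /not_implyP[iE /negP xL]].
    have iN : Ordinal nN = i by apply: val_inj.
    by rewrite /coord_event/= iN; exact/negP.
by apply: filterS SE => x xS; apply/memS => i; exact: xS.
Qed.

Lemma sum_indic (O : eqType) (s : seq O) (p b : pred O) (f : O -> R) (A : set O) :
  (forall x, A x <-> b x) ->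
  \sum_(x <- s | p x) f x * \1_A x = \sum_(x <- s | p x && b x) f x.
Proof.
move=> Ab; rewrite big_mkcond [RHS]big_mkcond/=; apply: eq_bigr => x _.
case: (p x) => //=; rewrite indicE.
case: (boolP (b x)) => bx; first by rewrite mem_set ?mulr1//; exact/Ab.
by rewrite memNset ?mulr0// => /Ab; exact/negP.
Qed.

Lemma multicausal_mass_marginal pi i (b : pred path) :
  multicausal mu pi -> measurable [set z | b z] ->
  \sum_(x <- S | b (tnth x i)) mass pi x = \sum_(z <- L i | b z) w i z.
Proof.
move=> mpi mb; have [marg _] := mpi.
have := marg i _ mb; rewrite (measure_supported measurable_set1_path (uL i) (sL i))//.
rewrite (measure_supported measurable_set1_paths uS (multicausal_supported mpi)).
  by rewrite (@sum_indic _ _ _ b)// (@sum_indic _ _ _ (fun x => b (tnth x i)))// => -[].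
exact: measurable_coord_event.
Qed.

(** It suffices to compare both sides on one atom of the joint history, that of
[y]. At time 0 these are the marginals. Later, that atom is the intersection of
the atom of [y] in the history of asset [i] with the event [B] that the other
assets follow [y]. The conditional probabilities [f] of [A], that asset [i]
follows [z], and [g] of [B] are constant on the former atom, of mass
[W i t z]: integrating [f], [g] and [f * g] over it gives the identity. *)
Lemma multicausal_causal_mass pi : multicausal mu pi ->
  causal_mass w L S (mass pi).
Proof.
move=> mpi i t z phi tT zL aphi; have [_ indep] := mpi.
have mH (y : path) : measurable [set x : path | take t x == take t y].
  rewrite (_ : [set x | _] = hist_event t y); first exact: measurable_hist.
  by apply/seteqP; split=> x /eqP.
have sS := multicausal_supported mpi.
apply/eqP; rewrite -subr_eq0 -[X in X * _ - _]/(W i t z); apply/eqP.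
pose c x := mass pi x *
  (W i t z * (tnth x i == z)%:R - w i z * (take t (tnth x i) == take t z)%:R).
transitivity (\sum_(x <- S) phi x * c x).
  rewrite [X in _ * X - _]big_mkcond [X in _ - _ * X]big_mkcond/= !big_distrr/=.
  rewrite -sumrB; apply: eq_bigr => x _; rewrite /c.
  by case: (tnth x i == z); case: (take t (tnth x i) == _);
    rewrite /= ?mulr1 ?mulr0; ring.
apply: (@sum_fibres _ _ _ S (joint_hist t)) => // y yS.
have [yz|yz] := eqVneq (take t (tnth y i)) (take t z); last first.
  apply: big1 => x /eqP/joint_histP/(_ i) xy; rewrite /c xy (negbTE yz).
  have [xz|_] := eqVneq (tnth x i) z; last by rewrite !mulr0 subrr mulr0.
  by rewrite -xz xy eqxx in yz.
case: t => [|t] in tT aphi mH c yz *.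
  have hT (x : paths) : joint_hist 0 x == joint_hist 0 y.
    by apply/eqP/joint_histP => j; rewrite !take0.
  under eq_bigl do rewrite hT.
  rewrite /c; under eq_bigr do rewrite mulrBr mulrCA (mulrCA _ (w i z)).
  rewrite sumrB -!big_distrr/=.
  have -> : \sum_(x <- S) mass pi x * (tnth x i == z)%:R = w i z.
    rewrite -[RHS](sum_pred1 (w i) (uL i) zL) -(multicausal_mass_marginal i mpi).
      rewrite [RHS]big_mkcond/=; apply: eq_bigr => x _.
      by case: eqP; rewrite ?mulr1 ?mulr0.
    rewrite (_ : [set _ | _] = [set z]); first exact: measurable_set1_path.
    by apply/seteqP; split=> x /= /eqP.
  have -> : \sum_(x <- S) mass pi x *
      (take 0 (tnth x i) == take 0 z)%:R = W i 0 z.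
    rewrite /hist_mass -(multicausal_mass_marginal i mpi (mH z)).
    rewrite [RHS]big_mkcond/=; apply: eq_bigr => x _.
    by case: eqP; rewrite ?mulr1 ?mulr0.
  by rewrite mulrC subrr.
have FiP := @coord_filtration_resolved R T N i t.+1.
pose A : set paths := [set x : paths | take T (tnth x i) = take T z].
pose B : set paths := [set x : paths | others_hist i t.+1 x = others_hist i t.+1 y].
have takeT (x : path) : take T x = x by rewrite take_oversize// size_tuple.
have AE x : A x <-> tnth x i == z.
  by rewrite /A/= !takeT; split=> [/val_inj ->//|/eqP ->].
have FA : natural_filtration (coord_of i) T A.
  have : natural_filtration (coord_of i) T
      [set x : paths | take T (tnth x i) = take T (tnth [tuple z | j < N] i)].
    exact: (resolved_atom (coord_filtration_resolved i T)).
  by rewrite tnth_mktuple.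
have FB : others_filtration i t.+1 B.
  exact: (resolved_atom (others_filtration_resolved i t.+1)).
have mA := resolved_measurable (coord_filtration_resolved i T) FA.
have mB := resolved_measurable (others_filtration_resolved i t.+1) FB.
have [f [g [fA gB fgAB]]] := indep i t.+1 ltac:(by []) A B FA FB.
have average D e : measurable D ->
    cond_expectation pi (natural_filtration (coord_of i) t.+1) \1_D e ->
    e y * W i t.+1 z =
    \sum_(x <- S | take t.+1 (tnth x i) == take t.+1 z) mass pi x * \1_D x.
  move=> mD [we _ eD].
  have FC := resolved_atom FiP y.
  have mC := resolved_measurable FiP FC.
  have := eD _ FC; rewrite !(integral_supported measurable_set1_paths uS sS)//;
    last exact: (measurable_wrt_measurable FiP we).
  move=> /(congr1 fine)/= eE; rewrite /hist_mass -(multicausal_mass_marginal i mpi (mH z)).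
  transitivity (\sum_(x <- S) (mass pi x * \1_D x) *
      \1_[set x : paths | take t.+1 (tnth x i) = take t.+1 (tnth y i)] x); last first.
    rewrite (@sum_indic _ _ _
      (fun x : paths => take t.+1 (tnth x i) == take t.+1 z))// => x /=.
    by rewrite yz; split=> /eqP.
  under [RHS]eq_bigr do rewrite -mulrA (mulrC (\1_D _)).
  rewrite -[RHS]eE [in LHS]big_mkcond/= big_distrr/=; apply: eq_bigr => x _.
  rewrite indicE; have [xz|xz] := eqVneq (take t.+1 (tnth x i)) (take t.+1 z).
    rewrite mem_set ?mul1r 1?mulrC//=; last by rewrite yz.
    congr (_ * _); apply: (measurable_wrt_eq FiP) => //.
    by rewrite yz xz.
  by rewrite memNset ?mul0r ?mulr0//= yz; exact/eqP.
have fW := average A f mA fA.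
have gW := average B g mB gB.
have fgW := average _ _ (measurableI _ _ mA mB) fgAB.
transitivity (W i t.+1 z * (f y * g y * W i t.+1 z) - w i z * (g y * W i t.+1 z)).
  have BE x : B x <-> others_hist i t.+1 x == others_hist i t.+1 y by split=> /eqP.
  have ABE x : (A `&` B) x <->
      (tnth x i == z) && (others_hist i t.+1 x == others_hist i t.+1 y).
    by split=> [[/AE -> /BE ->//]|/andP[/AE ? /BE ?]].
  rewrite fgW gW (sum_indic _ _ _ BE) (sum_indic _ _ _ ABE).
  rewrite big_mkcond [X in _ * X - _]big_mkcond [X in _ - _ * X]big_mkcond/=.
  rewrite !big_distrr/= -sumrB; apply: eq_bigr => x _; rewrite /c.
  have -> : (joint_hist t.+1 x == joint_hist t.+1 y) =
      (take t.+1 (tnth x i) == take t.+1 z) &&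
      (others_hist i t.+1 x == others_hist i t.+1 y).
    apply/eqP/andP => [/joint_histP xy|[/eqP xz /eqP/others_histP xy]].
      by split; [rewrite xy yz|apply/eqP/others_histP => j _].
    apply/joint_histP => j; have [->|ji] := eqVneq j i; first by rewrite xz yz.
    exact: xy.
  case: (take t.+1 (tnth x i) == _); case: (tnth x i == z);
    case: (others_hist i t.+1 x == _); rewrite /= ?mulr1 ?mulr0; ring.
have -> : w i z = f y * W i t.+1 z.
  rewrite fW (sum_indic _ _ _ AE) -[LHS](sum_pred1 (w i) (uL i) zL).
  rewrite -(multicausal_mass_marginal i mpi).
    apply: eq_bigl => x; case: eqP => [->|_]; last by rewrite andbF.
    by rewrite eqxx.
  rewrite (_ : [set _ | _] = [set z]); first exact: measurable_set1_path.
  by apply/seteqP; split=> x /= /eqP.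
ring.
Qed.

(** An event [A] of asset [i] only depends on the path of that asset, as recorded
by [alpha], and an event [B] of the other assets up to [t] is a function of the
joint history. Summing [causal_mass] over the paths [z] in [A], for [phi] the
indicator of [B] and for [phi] constant, shows that fibre averages over the
history of asset [i] multiply. *)
Lemma causal_multicausal pi : supported pi S ->
  causal_mass w L S (mass pi) -> multicausal mu pi.
Proof.
move=> sS pc.
have w1 i : \sum_(z <- L i) w i z = 1.
  exact: (mass_sum1 measurable_set1_path (uL i) (sL i)).
have pi1 := mass_sum1 measurable_set1_paths uS sS.
split=> [i A mA|i t /andP[t0 tT] A B FA FB].
  rewrite (measure_supported measurable_set1_paths uS sS); last first.
    exact: measurable_coord_event.
  rewrite (measure_supported measurable_set1_path (uL i) (sL i))//; congr EFin.
  transitivity (\sum_(x <- S) \1_A (tnth x i) * mass pi x).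
    by apply: eq_bigr => x _; rewrite mulrC.
  rewrite (sum_coord uL memS i (\1_A)); apply: eq_big_seq => z zL.
  by rewrite (causal_mass_marginal w1 pc zL) pi1 mulr1 mulrC.
have mA := resolved_measurable (coord_filtration_resolved i T) FA.
have mB := resolved_measurable (others_filtration_resolved i t) FB.
have rH := @coord_filtration_resolved R T N i t.
pose h (x : paths) := take t (tnth x i).
exists (fibre_average pi S h A), (fibre_average pi S h B).
have expect D := @fibre_average_cond_expectation R _ paths _
  measurable_set1_paths pi S _ h uS sS rH D.
split; [exact: expect|exact: expect|].
suff -> : (fun x => fibre_average pi S h A x * fibre_average pi S h B x) =
    fibre_average pi S h (A `&` B) by apply: expect; exact: measurableI.
apply/funext => x; rewrite /fibre_average.
suff key : fibre_mass pi S h A x * fibre_mass pi S h B x =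
    fibre_mass pi S h (A `&` B) x * fibre_mass pi S h setT x.
  have [->|T0] := eqVneq (fibre_mass pi S h setT x) 0; first by rewrite invr0 !mulr0.
  by rewrite mulrACA key; field.
have [[x0 x0S x0x]|none] := pselect (exists2 x0, x0 \in S & h x0 = h x); last first.
  have N0 D : fibre_mass pi S h D x = 0.
    apply: big1_seq => y /andP[/eqP yx yS]; exfalso; apply: none.
    by exists y.
  by rewrite !N0 !mul0r.
have x0L : tnth x0 i \in L i by apply: (memS x0).1.
pose alpha (z : path) : R := \1_A [tuple z | j < N].
have alphaE y : \1_A y = alpha (tnth y i).
  rewrite /alpha !indicE; suff -> : (y \in A) = ([tuple tnth y i | j < N] \in A) by [].
  have sat (u v : paths) : tnth u i = tnth v i -> A u -> A v.
    move=> uv; apply: (resolved_saturated (coord_filtration_resolved i T) FA).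
    by rewrite uv.
  by apply/idP/idP => /set_mem Ay; apply/mem_set; apply: sat Ay;
    rewrite tnth_mktuple.
pose W0 := W i t (tnth x0 i).
have split_alpha phi : adapted S t phi ->
    W0 * \sum_(y <- S | h y == h x) mass pi y * (\1_A y * phi y) =
    (\sum_(z <- L i) (take t z == h x)%:R * alpha z * w i z) *
    \sum_(y <- S | h y == h x) mass pi y * phi y.
  move=> aphi; pose beta (z : path) : R := (take t z == h x)%:R * alpha z.
  have -> : \sum_(y <- S | h y == h x) mass pi y * (\1_A y * phi y) =
      \sum_(y <- S) beta (tnth y i) * (mass pi y * phi y).
    rewrite big_mkcond; apply: eq_bigr => y _; rewrite alphaE /beta /h.
    by case: (_ == _); rewrite /= ?mul1r ?mul0r//; ring.
  rewrite (sum_coord uL memS i beta) big_distrr big_distrl/= /beta.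
  apply: eq_big_seq => z zL; case: eqP => zx; last by rewrite !mul0r mulr0.
  rewrite !mul1r mulrCA -!mulrA; congr (_ * _).
  have -> : W0 = W i t z by rewrite /W0 /hist_mass -[take t (tnth x0 i)]/(h x0) x0x -zx.
  by rewrite (pc i t z phi tT zL aphi) zx.
have B1 : adapted S t (\1_B : paths -> R).
  move=> u v _ _ /joint_histP uv; rewrite !indicE.
  suff -> : (u \in B) = (v \in B) by [].
  have sat (u' v' : paths) : others_hist i t u' = others_hist i t v' -> B u' -> B v'.
    exact: (resolved_saturated (others_filtration_resolved i t) FB).
  by apply/idP/idP => /set_mem Bu; apply/mem_set; apply: sat Bu;
    apply/others_histP => j _; rewrite uv.
have W00 : W0 != 0 by rewrite gt_eqF// W_gt0.
have EB := split_alpha _ B1.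
have T1 : adapted S t (\1_setT : paths -> R).
  by move=> u v _ _ _; rewrite indicT.
have ET := split_alpha _ T1.
apply: (mulfI W00); rewrite /fibre_mass mulrA mulrA.
have -> : \sum_(y <- S | h y == h x) mass pi y * \1_A y =
    \sum_(y <- S | h y == h x) mass pi y * (\1_A y * \1_setT y).
  by apply: eq_bigr => y _; rewrite indicT mulr1.
have -> : \sum_(y <- S | h y == h x) mass pi y * \1_(A `&` B) y =
    \sum_(y <- S | h y == h x) mass pi y * (\1_A y * \1_B y).
  by apply: eq_bigr => y _; rewrite indicI.
by rewrite ET EB mulrAC.
Qed.

End Transfer.

(** * Hedging *)

Section Hedging.
Context {R : realType} {T N : nat}.
Local Notation path := (T.-tuple R).
Local Notation paths := (N.-tuple (T.-tuple R)).
Variable mu : 'I_N -> probability path R.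
Variables (L : 'I_N -> seq path) (S : seq paths).
Hypothesis uS : uniq S.
Local Notation a := (fun i => asset (mu i)).

(** The position taken at a history is the sum of the entries of [v] at the points
of [S] with that history. These strategies form the vector space of the linear
program, and are adapted whatever [v] is. *)
Definition table_strategy (v : nat -> 'I_N -> paths -> R^o) (t : nat)
    (x : paths) : N.-tuple R :=
  [tuple \sum_(y <- S | joint_hist t y == joint_hist t x) (v t i y : R) | i < N].

Lemma table_strategyP v : strategy (table_strategy v).
Proof.
move=> t tT.
apply: (@measurable_wrt_atoms _ _ _ _ _ (joint_filtration_resolved t) _
  (N.-tuple R) (table_strategy v t) S [tuple 0 | i < N]) => [x y _ xy|x xS].
  by apply: eq_from_tnth => i; rewrite !tnth_mktuple xy.
apply: eq_from_tnth => i; rewrite !tnth_mktuple big1_seq// => y /andP[yx yS].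
by have := xS y yS; rewrite eq_sym yx.
Qed.

Lemma gainsE Delta x : gains mu Delta x =
  \sum_(t < T) \sum_(i < N) tnth (Delta t x) i * increment a i t x.
Proof. by []. Qed.

Lemma gains_scalar x : scalar (fun v => gains mu (table_strategy v) x).
Proof.
move=> b u v; rewrite !gainsE big_distrr -big_split/=; apply: eq_bigr => t _.
rewrite big_distrr -big_split/=; apply: eq_bigr => i _.
rewrite !tnth_mktuple.
have -> : \sum_(y <- S | joint_hist t y == joint_hist t x) (b *: u + v) t i y =
    b * (\sum_(y <- S | joint_hist t y == joint_hist t x) (u t i y : R)) +
    \sum_(y <- S | joint_hist t y == joint_hist t x) (v t i y : R).
  by rewrite big_distrr -big_split/=; apply: eq_bigr.
ring.
Qed.

(** The test strategy holds one unit of asset [i] over one period, at the history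
of [y]. *)
Lemma gains_zero_martingale_mass (p : paths -> R) :
  (forall v, \sum_(x <- S) p x * gains mu (table_strategy v) x = 0) ->
  martingale_mass a S p.
Proof.
move=> p0 i t y tT yS.
pose v (t' : nat) (i' : 'I_N) (y' : paths) : R^o :=
  ((t' == t) && (i' == i) && (y' == y))%:R.
rewrite -[RHS](p0 v) [LHS]big_mkcond/=; apply: eq_bigr => x _.
rewrite gainsE (bigD1 (Ordinal tT))//= (bigD1 i)//= !tnth_mktuple.
rewrite [X in _ * (_ + X + _)]big1 => [|j ji]; last first.
  rewrite tnth_mktuple big1 ?mul0r// => z _.
  by rewrite /v (negbTE ji) andbF.
rewrite [X in _ * (_ + _ + X)]big1 => [|s st]; last first.
  apply: big1 => j _; rewrite tnth_mktuple big1 ?mul0r// => z _.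
  rewrite /v (_ : (s == t :> nat) = false)//.
  by apply/negbTE; apply: contra st => /eqP st; apply/eqP/val_inj.
rewrite !addr0 /v !eqxx/=.
have -> : \sum_(z <- S | joint_hist t z == joint_hist t x) (z == y)%:R =
    (joint_hist t x == joint_hist t y)%:R :> R.
  rewrite big_mkcond (bigD1_seq y)//= eqxx [_ == joint_hist t y]eq_sym.
  rewrite big1 ?addr0 => [|z /negbTE ->]; first by case: eqP.
  by case: ifP.
by case: eqP; rewrite ?mul1r ?mul0r ?mulr0.
Qed.

Lemma strategy_adapted (Delta : nat -> paths -> N.-tuple R) i t :
  strategy Delta -> (t < T)%N -> adapted S t (fun x => tnth (Delta t x) i).
Proof.
move=> sD tT x y _ _ xy; congr (tnth _ i).
apply: (measurable_wrt_eq (joint_filtration_resolved t) _ (sD t tT) xy).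
by apply: measurable_set1_tuple => e; exact: measurable_set1.
Qed.

End Hedging.

Section Duality.
Context {R : realType} {T N : nat}.
Local Notation path := (T.-tuple R).
Local Notation paths := (N.-tuple (T.-tuple R)).
Hypothesis hT : (0 < T)%N.
Variable mu : 'I_N -> probability path R.
Hypothesis hmart : forall i, martingale (mu i) asset_filtration T (asset (mu i)).
Hypothesis hcompl : forall i, complete_market (mu i).
Variable xi : paths -> R.
Hypothesis hxi : measurable_fun setT xi.

(** The optimisers of the linear program on the finite set [S]. As every strategy
has centred gains under every multicausal coupling, all of [quasi_surely],
prices and expectations are decided on [S]. *)
Lemma superhedging_duality :
  exists p0 Delta (pistar : probability paths R),
    [/\ superhedges mu xi p0 Delta, p0%:E = superhedging_price mu xi,
        multicausal mu pistar, {ae pistar, forall x, p0 + gains mu Delta x = xi x} &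
        ('E_pistar[xi] = p0%:E)%E /\
        forall pi, multicausal mu pi -> ('E_pi[xi] <= p0%:E)%E].
Proof.
have /choice[L LP] i := complete_market_finite_support hT (hmart i) (@hcompl i).
have uL i : uniq (L i) by have [] := LP i.
have sL i : supported (mu i) (L i) by have [] := LP i.
have posL i z : z \in L i -> 0 < mass (mu i) z by have [_ _] := LP i; apply.
have [S [uS memS sumS]] := big_tuple_product R uL.
pose w i := mass (mu i); pose a i := asset (mu i).
have w1 i : \sum_(z <- L i) w i z = 1.
  exact: (mass_sum1 measurable_set1_path (uL i) (sL i)).
have wmart i t (y : path) : (t < T)%N ->
    \sum_(z <- L i | take t z == take t y) w i z * (a i t.+1 z - a i t z) = 0.
  exact: (finite_martingale (hmart i) (uL i) (sL i)).
have wrepl i z := finite_replication hT (@hcompl i) (uL i) (sL i) (posL i) (z := z).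
have gains0 p Delta : causal_mass w L S p -> strategy Delta ->
    \sum_(x <- S) p x * gains mu Delta x = 0.
  move=> pc sD; under eq_bigr do rewrite gainsE big_distrr/=.
  rewrite exchange_big big1//= => t _.
  under eq_bigr do rewrite big_distrr/=.
  rewrite exchange_big big1//= => i _; under eq_bigr do rewrite mulrA.
  apply: (causal_mass_increment uL posL wmart memS i pc (ltn_ord t)).
  exact: strategy_adapted.
have product_feasible : dual_feasible S
    (fun x v => gains mu (table_strategy S v) x) (product_mass w).
  split=> [x||v]; first by apply: prodr_ge0 => i _; exact: mass_ge0.
    exact: (product_mass_sum1 w1 sumS).
  apply: gains0; last exact: table_strategyP.
  apply: (martingale_causal_mass uL posL wrepl memS).
  exact: (product_mass_martingale wmart sumS).
have [p [v [c [hedge [c0 c1 cg] cp]]]] := lp_strong_duality xi uS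
  (gains_scalar mu S) (ex_intro _ _ product_feasible).
have [P [PS Pc]] := discrete_probability uS c0 c1.
have Psum (f : paths -> R) :
    \sum_(x <- S) mass P x * f x = \sum_(x <- S) c x * f x.
  by apply: eq_big_seq => x xS; rewrite Pc.
have Pcausal : causal_mass w L S (mass P).
  apply: (martingale_causal_mass uL posL wrepl memS).
  apply: gains_zero_martingale_mass => // u; exact: (etrans (Psum _) (cg u)).
have Pmc : multicausal mu P by exact: causal_multicausal Pcausal.
have EP : ('E_P[xi] = p%:E)%E.
  by rewrite (expectation_supported measurable_set1_paths uS PS)// Psum cp.
pose Delta := table_strategy S v.
have sD : strategy Delta by exact: table_strategyP.
have mean pi Delta' q : multicausal mu pi -> strategy Delta' ->
    \sum_(x <- S) mass pi x * (q + gains mu Delta' x) = q.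
  move=> mpi sD'; under eq_bigr do rewrite mulrDr.
  rewrite big_split/= gains0 ?addr0//; last exact: multicausal_causal_mass mpi.
  rewrite -big_distrl/= (mass_sum1 measurable_set1_paths uS) ?mul1r//.
  exact: multicausal_supported mpi.
have sh : superhedges mu xi p Delta.
  split => //; exists (~` [set` S]); split.
  - exact: (measurableC (measurable_seq measurable_set1_paths S)).
  - move=> pi mpi; exact: multicausal_supported mpi.
  - by move=> x /contrapT; exact: hedge.
exists p, Delta, P; split => //.
- apply/eqP; rewrite eq_le; apply/andP; split; last first.
    by apply: ereal_inf_lbound; exists p => //; exists Delta.
  apply: le_ereal_inf_tmp => _ [q [Delta' [sD' [B [mB B0 NB]]]] <-].
  rewrite lee_fin -cp -Psum -(mean P Delta' q Pmc sD').
  rewrite big_seq [leRHS]big_seq; apply: ler_sum => x xS.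
  have := mass_ge0 P x; rewrite le_eqVlt => /orP[/eqP <-|Px].
    by rewrite !mul0r.
  rewrite ler_pM2l//; apply: NB => Bx.
  have : (P [set x] <= P B)%E.
    by rewrite le_measure ?inE//; [exact: measurable_set1_paths|move=> _ ->].
  by rewrite B0// (massE measurable_set1_paths) lee_fin leNgt Px.
- apply: (ae_supported measurable_set1_paths uS PS) => x xS Px.
  (* the hedging error is nonnegative with mean 0 *)
  have gap0 : \sum_(y <- S) mass P y * (p + gains mu Delta y - xi y) = 0.
    under eq_bigr do rewrite mulrBr.
    by rewrite sumrB mean// Psum cp subrr.
  move: gap0 => /eqP; rewrite big_seq psumr_eq0 => [|y yS]; last first.
    by rewrite mulr_ge0 ?mass_ge0// subr_ge0 hedge.
  move=> /allP/(_ x xS); rewrite xS/= mulf_eq0 gt_eqF//= subr_eq0.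
  by move=> /eqP.
- split => // pi mpi; have piS : supported pi S by exact: multicausal_supported mpi.
  rewrite (expectation_supported measurable_set1_paths uS piS)// lee_fin.
  rewrite -[leRHS](mean pi Delta p mpi sD) big_seq [leRHS]big_seq.
  by apply: ler_sum => x xS; rewrite ler_wpM2l ?mass_ge0// hedge.
Qed.

End Duality.

Theorem theorem3p7 (R : realType) (T N : nat) (hT : (0 < T)%N)
  (mu : 'I_N -> probability (T.-tuple R) R)
  (hmart : forall i, martingale (mu i) asset_filtration T (asset (mu i)))
  (hcompl : forall i, complete_market (mu i))
  (xi : N.-tuple (T.-tuple R) -> R)
  (hxi : measurable_fun setT xi)
  (hub : exists f : 'I_N -> T.-tuple R -> R,
     (forall i, (mu i).-integrable setT (EFin \o f i)) /\
     (forall x, xi x <= \sum_(i < N) f i (tnth x i))) :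
  (exists (p0 : R) (Delta : nat -> N.-tuple (T.-tuple R) -> N.-tuple R),
     superhedges mu xi p0 Delta /\ p0%:E = superhedging_price mu xi) /\
  (upper_semicontinuous xi ->
   (exists h : 'I_N -> T.-tuple R -> R,
      (forall i, (mu i).-integrable setT (EFin \o h i)) /\
      (forall x, - xi x <= \sum_(i < N) h i (tnth x i))) ->
   exists pistar : probability (N.-tuple (T.-tuple R)) R,
     [/\ multicausal mu pistar,
         ('E_pistar[xi] =
           ereal_sup [set 'E_pi[xi] | pi in multicausal mu])%E &
         exists (Deltastar : nat -> N.-tuple (T.-tuple R) -> N.-tuple R)
                (p0star : R),
           [/\ strategy Deltastar,
               p0star%:E = superhedging_price mu xi,
               quasi_surely mu
                 (fun x => p0star + gains mu Deltastar x >= xi x),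
               {ae pistar, forall x,
                  p0star + gains mu Deltastar x = xi x} &
               (superhedging_price mu xi = 'E_pistar[xi])%E]]).
Proof.
have [p0 [Delta [P [sh pE mP aeP [EP Ple]]]]] :=
  superhedging_duality hT hmart hcompl hxi.
split=> [|_ _]; first by exists p0, Delta.
exists P; split => //.
  apply/eqP; rewrite eq_le; apply/andP; split.
    by apply: ereal_sup_ubound; exists P.
  by rewrite EP; apply: ge_ereal_sup => _ [pi mpi <-]; exact: Ple.
by exists Delta, p0; have [sD qs] := sh; split => //; rewrite -pE EP.
Qed.
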